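(* Let $(p_n)_{n\ge 1}$, $p_n\in(0,1)$, be a decreasing sequence such that (A) $\lim_{n\to\infty} n p_n=\infty$; (B) $\lim_{n\to\infty} n p_n^r=0$ for some integer $r\ge 2$; (C) for any map $\phi\colon\mathbb{N}\to\mathbb{N}$ with $\lim_{n\to\infty}|n-\phi(n)|/(n\wedge\phi(n))=0$, one has $\lim_{n\to\infty}p_n/p_{\phi(n)}=1$. Then there exist an infinite set $\mathcal{N}\subseteq\mathbb{N}$ and Boolean functions $f_n\colon\{0,1\}^n\to\{0,1\}$, $n\in\mathcal{N}$, such that, with respect to $(p_n)$, the sequence $(f_n)_{n\in\mathcal{N}}$ is (a) non-degenerate, (b) transitive, (c) tame, and (d) satisfies $\lim_{n\to\infty}\mathbb{E}[C_n(f_n)]=\infty$ (limits taken along $n\in\mathcal{N}$).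
   Context: For $n\ge1$ and $p_n\in(0,1)$, $X^{(n)}=(X^{(n)}_t)_{t\ge0}$ is the continuous-time $p_n$-biased random walk on $\{0,1\}^n$: independently for each coordinate $i\in[n]=\{1,\dots,n\}$, at the times of a rate-one Poisson process the coordinate $X^{(n)}_t(i)$ is resampled according to $(1-p_n)\delta_0+p_n\delta_1$ (independently of the Poisson process). $X^{(n)}_0$ is distributed according to the stationary measure $\pi_n=((1-p_n)\delta_0+p_n\delta_1)^{\otimes n}$. For a Boolean function $f_n\colon\{0,1\}^n\to\{0,1\}$, $C_n=C_n(f_n)$ is the (random) number of times in $(0,1)$ at which $t\mapsto f_n(X^{(n)}_t)$ changes value, i.e. $C_n=\lim_{N\to\infty}\sum_{i=0}^{N-1}\mathbf{1}(f_n(X^{(n)}_{i/N})\ne f_n(X^{(n)}_{(i+1)/N}))$. Sequences are indexed by an infinite set $\mathcal{N}=\{n_1<n_2<\dots\}\subseteq\mathbb{N}$ and $\lim_{n\to\infty}$ means the limit along $\mathcal{N}$. The sequence $(f_n)_{n\in\mathcal{N}}$ is: non-degenerate if $0<\liminf_{n}P(f_n(X_0^{(n)})=1)\le\limsup_n P(f_n(X_0^{(n)})=1)<1$; transitive if for each $n$ and all $i,j\in[n]$ there is a permutation $\sigma$ of $[n]$ with $\sigma(i)=j$ and $f_n(x)=f_n((x(\sigma(k)))_{k\in[n]})$ for all $x\in\{0,1\}^n$; tame if $(C_n)$ is tight, i.e. for every $\varepsilon>0$ there are $k\ge1$ and $n_0$ with $P(C_n\ge k)<\varepsilon$ for all $n\in\mathcal{N}$,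 $n\ge n_0$. *)

(* Defs.v *)
From HB Require Import structures.
From mathcomp Require Import all_boot all_order all_algebra all_fingroup.
From mathcomp Require Import all_classical all_reals all_analysis.
Set Implicit Arguments. Unset Strict Implicit. Unset Printing Implicit Defensive.
Import Order.TTheory GRing.Theory Num.Theory.
Import numFieldNormedType.Exports.
Local Open Scope classical_set_scope.
Local Open Scope ring_scope.

Notation cube n := {ffun 'I_n -> bool}.

Section Defs.
Variable R : realType.

Definition bern (p : R) (b : bool) : R := if b then p else 1 - p.

Definition pi_meas n (p : R) (x : cube n) : R := \prod_(i < n) bern p (x i).

(* transition probability over time s of the p-biased walk:
   each coordinate is resampled at least once during time s with
   probability 1 - e^{-s} (rate-one Poisson clock). *)
Definition trans_kernel n (p s : R) (x y : cube n) : R :=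
  \prod_(i < n) (expR (- s) * (x i == y i)%:R + (1 - expR (- s)) * bern p (y i)).

(* X is (a version of) the continuous-time p-biased random walk on {0,1}^n
   started from pi_n, on the probability space (Omega, P): its one-time
   events are measurable and its finite-dimensional distributions are
   those of the Markov process with initial law pi_n and semigroup
   trans_kernel. *)
Definition biased_rw {d : measure_display} {Omega : measurableType d}
  (P : probability Omega R) n (p : R) (X : R -> Omega -> cube n) : Prop :=
  (forall t (x : cube n), measurable [set w | X t w = x]) /\
  forall (m : nat) (t : nat -> R) (x : nat -> cube n),
    0 <= t 0%N -> (forall j, t j <= t j.+1) ->
    P [set w | forall j, (j <= m)%N -> X (t j) w = x j] =
    (pi_meas p (x 0%N) *
       \prod_(j < m) trans_kernel p (t j.+1 - t j) (x j) (x j.+1))%:E.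

Definition grid_changes {Omega : Type} n (f : cube n -> bool)
  (X : R -> Omega -> cube n) (N : nat) (w : Omega) : nat :=
  \sum_(i < N) (f (X (i%:R / N%:R) w) != f (X (i.+1%:R / N%:R) w)).

Definition switch_count {Omega : Type} n (f : cube n -> bool)
  (X : R -> Omega -> cube n) (w : Omega) : \bar R :=
  limn (fun N => ((grid_changes f X N w)%:R)%:E).

End Defs.

Definition transitive_fun n (f : cube n -> bool) : Prop :=
  forall i j : 'I_n, exists s : {perm 'I_n},
    s i = j /\ forall x : cube n, f x = f [ffun k => x (s k)].

(* Main.v *)
(** Replacing [r] by [r + 1] we may assume [n p_n^r -> 0] with [r >= 3].  Cut
    [n] into [b] consecutive blocks of length [m], where [lambda = b (m p_n)^r]
    is bounded and bounded away from [0]; then [m -> oo] and [m p_n -> 0].  Let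
    [f] be "some block contains at least [r] ones", except that on the event
    [A] that some block contains at least [r + 1] ones [f] is the parity of the
    total number of ones.

    [P(A) <= lambda m p_n -> 0], and [A] is also unlikely to occur at any time
    in [0, 1]; off [A], [f] changes at rate at most [2 r lambda].  So [f] is
    non-degenerate and tame.  But on [A] every flip of a coordinate from [0] to
    [1] switches [f], so [E C_n] is at least of the order
    [n p_n P(A) ~ n p_n (m p_n) ~ (n p_n)^(1 - 1/(r - 1))], which tends to
    infinity because [r >= 3]. *)
Require Import Defs.
From HB Require Import structures.
From mathcomp Require Import all_boot all_order all_algebra all_fingroup.
From mathcomp Require Import all_classical all_reals all_analysis.
From mathcomp Require Import measurable_realfun ring lra zify.
Import Order.TTheory GRing.Theory Num.Theory.
Import numFieldNormedType.Exports.
Set Implicit Arguments. Unset Strict Implicit. Unset Printing Implicit Defensive.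

(** * Blocks of coordinates *)

(** Parity is the right modification on [A]: it makes every coordinate pivotal and is invariant
    under all permutations, so it costs no symmetry. Two obstacles shape the rest. Equal blocks
    require [m] to divide [n] while [lambda] stays in a fixed window, but a length fitted to a given
    [n] need not divide it. So [n] is rounded to a multiple of the length, (C) controls the
    resulting change of [p_n], and the functions are used only along an infinite set of indices.
    Moreover the process is known only through its finite-dimensional laws, and [limn] takes a
    default value where the grid counts diverge. The tail bound survives this, since a limit
    [>= k > 0] means that the counts are eventually [>= k]. The lower bound on the expectation needs
    almost sure convergence of the counts. All probabilities are thereby reduced to finite sums over
    the cube: one-time weights [mu] and two-time weights [nu]. By stationarity a grid of [N] steps
    has expected count [N * nu] with time step [1 / N]. *)

Section Blocks.
Variables (n m : nat).

Definition ones (x : cube n) : {set 'I_n} := [set i | x i]%SET.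
Definition blk (j : nat) : {set 'I_n} := [set i : 'I_n | i %/ m == j]%SET.
Definition crowded (r : nat) (x : cube n) : bool :=
  [exists j : 'I_n, (r <= #|blk j :&: ones x|)%N].
Definition fblk (r : nat) (x : cube n) : bool :=
  if crowded r.+1 x then odd #|ones x| else crowded r x.

Hypotheses (m0 : (0 < m)%N) (mn : (m %| n)%N).

Lemma card_blk j : (j < n %/ m)%N -> #|blk j| = m.
Proof.
move=> jb.
have lt (k : 'I_m) : (j * m + k < n)%N.
  rewrite -(divnK mn); have := leq_mul2r m j.+1 (n %/ m).
  rewrite jb orbT mulSn => /esym; have := ltn_ord k; lia.
pose h (k : 'I_m) : 'I_n := Ordinal (lt k).
have hinj : injective h by move=> a b [] /addnI /val_inj.
rewrite -[RHS]card_ord -cardsT -(card_imset _ hinj); apply: eq_card => i.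
rewrite inE; apply/eqP/imsetP => [ij|[k _ ->]]; last first.
  by rewrite /= divnMDl// divn_small ?addn0.
exists (Ordinal (ltn_pmod i m0)) => //; apply: val_inj => /=.
by rewrite -ij -divn_eq.
Qed.

Lemma blk_disj j j' : j != j' -> [disjoint blk j & blk j'].
Proof.
move=> jj; rewrite -setI_eq0; apply/eqP/setP => i; rewrite !inE.
by apply/negP => /andP[/eqP-> /eqP e]; rewrite e eqxx in jj.
Qed.

Lemma crowdedS r x : crowded r.+1 x -> crowded r x.
Proof. by move=> /existsP[j /ltnW h]; apply/existsP; exists j. Qed.

(** Witnesses are [r]-sets rather than blocks because the event that a fixed [r]-set consists of
    ones has the exact weight [p ^+ r]; the union bounds below range over such sets. *)
Lemma crowdedP r x : (0 < r)%N ->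
  reflect (exists j : 'I_(n %/ m), exists S : {set 'I_n},
    [/\ S \subset blk j, #|S| = r & S \subset ones x]) (crowded r x).
Proof.
move=> r0; apply: (iffP existsP) => [[j rj]|[j [S [Sj Sr Sx]]]].
  have /set0Pn[S] : [set S : {set 'I_n} | S \subset blk j :&: ones x & #|S| == r]%SET != finset.set0.
    by rewrite -card_gt0 cards_draws bin_gt0.
  rewrite inE finset.subsetI => /andP[/andP[Sj Sx] /eqP Sr].
  have jb : (j < n %/ m)%N.
    have /card_gt0P[i] : (0 < #|S|)%N by rewrite Sr.
    move=> /(fintype.subsetP Sj); rewrite inE => /eqP <-.
    by rewrite ltn_divLR// divnK.
  by exists (Ordinal jb), S.
have jn : (j < n)%N.
  by apply: (leq_trans (ltn_ord j)); apply: leq_div.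
exists (Ordinal jn); rewrite -Sr; apply: subset_leq_card.
by rewrite finset.subsetI Sj.
Qed.

Definition swapn (a b k : nat) := if k == a then b else if k == b then a else k.

Lemma swapnK a b : involutive (swapn a b).
Proof.
move=> k; rewrite /swapn; have [->|ka] := eqVneq k a.
  by rewrite eqxx; case: eqVneq.
have [->|kb] := eqVneq k b; first by rewrite eqxx.
by rewrite (negPf ka) (negPf kb).
Qed.

Lemma swapn_lt a b k c :
  (a < c)%N -> (b < c)%N -> (k < c)%N -> (swapn a b k < c)%N.
Proof. by move=> ac bc kc; rewrite /swapn; case: ifP => // _; case: ifP. Qed.

Section Swap.
Variables i j : 'I_n.

(** Under the identification of coordinates with pairs (block, position in the block), this is the
    product of two transpositions. It therefore carries blocks onto blocks. *)
Definition bswap_nat (k : nat) :=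
  (swapn (i %/ m) (j %/ m) (k %/ m) * m + swapn (i %% m) (j %% m) (k %% m))%N.

Let small k : (swapn (i %% m) (j %% m) (k %% m) < m)%N.
Proof. by apply: swapn_lt; rewrite ltn_pmod. Qed.

Lemma bswap_div k : (bswap_nat k %/ m)%N = swapn (i %/ m) (j %/ m) (k %/ m).
Proof. by rewrite /bswap_nat divnMDl// (divn_small (small k)) addn0. Qed.

Lemma bswap_mod k : (bswap_nat k %% m)%N = swapn (i %% m) (j %% m) (k %% m).
Proof. by rewrite /bswap_nat modnMDl modn_small ?small. Qed.

Lemma bswap_natK : involutive bswap_nat.
Proof.
move=> k; rewrite {1}/bswap_nat bswap_div bswap_mod !swapnK.
by rewrite -divn_eq.
Qed.

Lemma bswap_lt (k : 'I_n) : (bswap_nat k < n)%N.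
Proof.
have dlt (l : 'I_n) : (l %/ m < n %/ m)%N by rewrite ltn_divLR// divnK.
rewrite -[X in (_ < X)%N](divnK mn) -ltn_divLR// bswap_div.
exact: swapn_lt.
Qed.

Definition bswap (k : 'I_n) : 'I_n := Ordinal (bswap_lt k).

Lemma bswapK : involutive bswap.
Proof. by move=> k; apply: val_inj; rewrite /= bswap_natK. Qed.

Definition bswapp : {perm 'I_n} := perm (can_inj bswapK).

Lemma bswapp1 : bswapp i = j.
Proof.
by apply: val_inj; rewrite permE /= /bswap_nat /swapn !eqxx -divn_eq.
Qed.

Lemma ones_bswap (x : cube n) : ones [ffun k => x (bswapp k)] = bswap @: ones x.
Proof.
apply/setP => k; rewrite !inE ffunE permE; apply/idP/imsetP => [xk|[l]].
  by exists (bswap k); rewrite ?inE ?bswapK.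
by rewrite inE => xl ->; rewrite bswapK.
Qed.

Lemma crowded_bswap r (x : cube n) : crowded r x -> crowded r [ffun k => x (bswapp k)].
Proof.
case: (posnP r) => [->|r0].
  by move=> /existsP[j0 _]; apply/existsP; exists j0.
move=> /(crowdedP _ r0)[a [S [Sa Sr Sx]]]; apply/(crowdedP _ r0).
have ab : (swapn (i %/ m) (j %/ m) a < n %/ m)%N.
  by apply: swapn_lt; rewrite // ltn_divLR// divnK.
exists (Ordinal ab), (bswap @: S); split.
- apply/fintype.subsetP => k /imsetP[l /(fintype.subsetP Sa)]; rewrite !inE.
  by move=> /eqP la ->; rewrite /= bswap_div la.
- by rewrite card_imset//; exact: can_inj bswapK.
- by rewrite ones_bswap; exact: imsetS.
Qed.

End Swap.

Lemma fblk_transitive r : transitive_fun (fblk r).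
Proof.
move=> i j; exists (bswapp i j); split; first exact: bswapp1.
move=> x; set y := [ffun k => _].
(* The swap is an involution, so [x] is in turn the swap of [y], and the one-sided [crowded_bswap]
   gives both directions. *)
have xE : x = [ffun k => y (bswapp i j k)].
  by apply/ffunP => k; rewrite !ffunE !permE bswapK.
have dE q : crowded q x = crowded q y.
  by apply/idP/idP => [|h]; [|rewrite xE]; exact: crowded_bswap.
rewrite /fblk !dE ones_bswap card_imset//; exact: can_inj (@bswapK i j).
Qed.

End Blocks.

Local Open Scope ring_scope.

(** * Static estimates on the cube *)

Section FiniteWeights.
Variables (R : realType) (T I : finType) (w : T -> R) (w_ge0 : forall x, 0 <= w x).

Lemma weight_le (E F : pred T) : (forall x, E x -> F x) ->
  \sum_(x | E x) w x <= \sum_(x | F x) w x.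
Proof.
move=> EF; rewrite big_mkcond [leRHS]big_mkcond; apply: ler_sum => x _.
by case: ifP => [/EF ->//|_]; case: ifP.
Qed.

Lemma weight_union (E : pred T) (Q : pred I) (F : I -> pred T) :
  (forall x, E x -> exists k, Q k && F k x) ->
  \sum_(x | E x) w x <= \sum_(k | Q k) \sum_(x | F k x) w x.
Proof.
move=> EF; under [leRHS]eq_bigr do rewrite big_mkcond.
rewrite exchange_big big_mkcond; apply: ler_sum => x _.
have h0 k : Q k -> 0 <= (if F k x then w x else 0) by case: ifP.
case: ifP => [/EF[k /andP[Qk Fk]]|_]; last exact: sumr_ge0.
rewrite (bigD1 k)//= Fk lerDl; apply: sumr_ge0 => l /andP[Ql _]; exact: h0.
Qed.

(** With [Z] the number of events holding at a point, this is the sum of the pointwise bound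
    [Z - (Z^2 - Z) / 2 <= 1], both sides being replaced by [0] where [E] fails. The pairs are
    ordered, hence [2^-1]. *)
Lemma weight_bonferroni (E : pred T) (Q : pred I) (F : I -> pred T) :
  (forall k x, Q k -> F k x -> E x) ->
  \sum_(k | Q k) \sum_(x | F k x) w x -
   2^-1 * \sum_(k | Q k) \sum_(l | Q l && (l != k)) \sum_(x | F k x && F l x) w x
  <= \sum_(x | E x) w x.
Proof.
move=> FE.
pose Z x : R := \sum_(k | Q k) (F k x)%:R.
have ZE : \sum_(k | Q k) \sum_(x | F k x) w x = \sum_x w x * Z x.
  under eq_bigr do rewrite big_mkcond.
  rewrite exchange_big; apply: eq_bigr => x _.
  rewrite mulr_sumr; apply: eq_bigr => k _.
  by case: ifP; rewrite ?mulr1 ?mulr0.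
have Z2E : \sum_(k | Q k) \sum_(l | Q l && (l != k)) \sum_(x | F k x && F l x) w x
   = \sum_x w x * (Z x ^+ 2 - Z x).
  under eq_bigr do under eq_bigr do rewrite big_mkcond.
  under eq_bigr do rewrite exchange_big.
  rewrite exchange_big; apply: eq_bigr => x _.
  have -> : Z x ^+ 2 - Z x = \sum_(k | Q k) \sum_(l | Q l && (l != k)) (F k x && F l x)%:R.
    rewrite expr2 {1}/Z mulr_suml -sumrB; apply: eq_bigr => k Qk.
    rewrite {1}/Z (bigD1 k)//= mulrDr -natrM mulnb andbb addrAC subrr add0r.
    by rewrite mulr_sumr; apply: eq_bigr => l _; rewrite -natrM mulnb.
  rewrite mulr_sumr; apply: eq_bigr => k _.
  rewrite mulr_sumr; apply: eq_bigr => l _.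
  by case: ifP; rewrite ?mulr1 ?mulr0.
rewrite ZE Z2E [leRHS]big_mkcond mulr_sumr -sumrB; apply: ler_sum => x _.
have ZN : Z x = (\sum_(k | Q k) F k x)%N%:R by rewrite natr_sum.
case: ifPn => [_|nE].
  rewrite mulrCA -mulrBr -[leRHS]mulr1; apply: ler_wpM2l => //.
  (* The bound amounts to [(Z - 1) (Z - 2) >= 0], which fails strictly between 1 and 2, so
     integrality of [Z] has to be used. *)
  rewrite ZN; case: (\sum_(k | Q k) F k x)%N => [|[|[|k]]].
  - by rewrite expr2; lra.
  - by rewrite expr2; lra.
  - by rewrite expr2; lra.
  - have : 0 <= k%:R :> R by [].
    rewrite -addn3 natrD; move: (k%:R) => a a0; nra.
rewrite [Z x]big1 ?expr2 ?mulr0 ?subrr ?mulr0// => k Qk.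
by case: (boolP (F k x)) => // /FE -/(_ Qk); rewrite (negPf nE).
Qed.

End FiniteWeights.

Section Arith.
Variable R : realType.

Lemma bernoulli_ineq (a : R) k : 0 <= a <= 1 -> 1 - k%:R * a <= (1 - a) ^+ k.
Proof.
move=> /andP[a0 a1]; elim: k => [|k IH]; first by rewrite expr0 mul0r subr0.
rewrite exprS -natr1; apply: le_trans (_ : (1 - a) * (1 - k%:R * a) <= _).
  have : 0 <= k%:R :> R by [].
  by nra.
by apply: ler_wpM2l => //; rewrite subr_ge0.
Qed.

Lemma bin_le_exp m r : ('C(m, r) <= m ^ r)%N.
Proof.
apply: (@leq_trans (m ^_ r)); first by rewrite -bin_ffact leq_pmulr ?fact_gt0.
elim: r => [|r IH]; first by rewrite ffactn0.
by rewrite ffactnSr expnSr leq_mul// leq_subr.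
Qed.

(** Each of the [r] factors of the falling factorial is at least [m / 2]. *)
Lemma exp_le_bin m r : (2 * r <= m)%N -> (m ^ r <= 2 ^ r * (r`! * 'C(m, r)))%N.
Proof.
move=> rm; rewrite [(r`! * _)%N]mulnC bin_ffact.
have H k : (k <= r)%N -> (m ^ k <= 2 ^ k * m ^_ k)%N.
  elim: k => [|k IH] kr; first by rewrite ffactn0.
  rewrite ffactnSr !expnSr mulnACA leq_mul ?IH//; first exact: ltnW.
  lia.
exact: H.
Qed.

End Arith.

(** * One-time and two-time weights of coordinate events *)

Section Cube.
Variables (R : realType) (n : nat) (p : R).
Hypothesis p01 : 0 <= p <= 1.
Implicit Types (s : R) (S A : {set 'I_n}) (x y : cube n).

Let p0 : 0 <= p. Proof. by case/andP: p01. Qed.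
Let p1 : 0 <= 1 - p. Proof. by rewrite subr_ge0; case/andP: p01. Qed.

Lemma bern_ge0 b : 0 <= bern p b. Proof. by case: b. Qed.

Lemma sum_bool (g : bool -> R) : \sum_b g b = g true + g false.
Proof. by rewrite (bigD1 true)//= (bigD1 false)//= big1 ?addr0// => -[]. Qed.

Lemma pi_meas_ge0 x : 0 <= pi_meas p x.
Proof. by apply: prodr_ge0 => i _; exact: bern_ge0. Qed.

Lemma exp_range s : 0 <= s -> 0 <= expR (- s) <= 1.
Proof. by move=> s0; rewrite expR_ge0 -expR0 ler_expR oppr_le0. Qed.

Lemma step_ge s (a b : bool) : 0 <= s ->
  expR (- s) * (a == b)%:R <= expR (- s) * (a == b)%:R + (1 - expR (- s)) * bern p b.
Proof.
move=> /exp_range/andP[e0 e1].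
by rewrite lerDl mulr_ge0 ?bern_ge0// subr_ge0.
Qed.

Lemma trans_kernel_ge0 s x y : 0 <= s -> 0 <= trans_kernel p s x y.
Proof.
move=> s0; apply: prodr_ge0 => i _; apply: le_trans (step_ge _ _ s0).
by rewrite mulr_ge0 ?expR_ge0.
Qed.

Lemma trans_kernel_refl s x : 0 <= s -> expR (- s) ^+ n <= trans_kernel p s x x.
Proof.
move=> s0; rewrite -[X in _ ^+ X]card_ord -prodr_const; apply: ler_prod => i _.
by rewrite expR_ge0/=; have := step_ge (x i) (x i) s0; rewrite eqxx mulr1.
Qed.

Definition mu (E : pred (cube n)) : R := \sum_(x | E x) pi_meas p x.
Definition nu s (E : rel (cube n)) : R :=
  \sum_(z : cube n * cube n | E z.1 z.2) pi_meas p z.1 * trans_kernel p s z.1 z.2.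

Lemma nu_weight_ge0 s (z : cube n * cube n) : 0 <= s ->
  0 <= pi_meas p z.1 * trans_kernel p s z.1 z.2.
Proof. by move=> s0; rewrite mulr_ge0 ?pi_meas_ge0 ?trans_kernel_ge0. Qed.

(** Independence of the coordinates, as distributivity of the product over the sum. The exact
    weights of sets of ones and of cylinders come from this and its two-time analogue [nu_prod]. *)
Lemma mu_prod (E : pred (cube n)) (h : 'I_n -> bool -> bool) :
  (forall x, E x = [forall i, h i (x i)]) ->
  mu E = \prod_i \sum_b bern p b * (h i b)%:R.
Proof.
move=> Eh; rewrite bigA_distr_bigA /mu big_mkcond; apply: eq_bigr => x _.
rewrite big_split/= Eh; case: ifPn => [/forallP hx|].
  by rewrite [X in _ = _ * X]big1 ?mulr1// => i _; rewrite hx.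
rewrite negb_forall => /existsP[i hi].
by rewrite [X in _ = _ * X](bigD1 i)//= (negPf hi) mul0r mulr0.
Qed.

Lemma nu_prod s (E : rel (cube n)) (h : 'I_n -> bool -> bool -> bool) :
  (forall x y, E x y = [forall i, h i (x i) (y i)]) ->
  nu s E = \prod_i \sum_a \sum_b
    bern p a * (expR (- s) * (a == b)%:R + (1 - expR (- s)) * bern p b) * (h i a b)%:R.
Proof.
move=> Eh; rewrite bigA_distr_bigA /nu big_mkcond.
rewrite -(pair_bigA _ (fun x y => if E x y then pi_meas p x * trans_kernel p s x y else 0))/=.
apply: eq_bigr => x _; rewrite bigA_distr_bigA; apply: eq_bigr => y _.
rewrite !big_split/= Eh; case: ifPn => [/forallP hx|].
  by rewrite [X in _ = _ * X]big1 ?mulr1// => i _; rewrite hx.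
rewrite negb_forall => /existsP[i hi].
by rewrite [X in _ = _ * X](bigD1 i)//= (negPf hi) mul0r mulr0.
Qed.

Lemma prod_if_set (S : {set 'I_n}) (c : R) :
  \prod_i (if i \in S then c else 1) = c ^+ #|S|.
Proof. by rewrite -big_mkcond prodr_const. Qed.

Lemma mu_ones S : mu (fun x => S \subset ones x) = p ^+ #|S|.
Proof.
rewrite (@mu_prod _ (fun i b => (i \in S) ==> b)); last first.
  move=> x; apply/fintype.subsetP/forallP => [h i|h i iS].
    by apply/implyP => /h; rewrite inE.
  by rewrite inE; have /implyP := h i; apply.
rewrite -prod_if_set; apply: eq_bigr => i _; rewrite sum_bool /=.
by case: ifP => _ /=; ring.
Qed.

Lemma nu_ones1 s S : nu s (fun x _ => S \subset ones x) = p ^+ #|S|.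
Proof.
rewrite (@nu_prod _ _ (fun i a _ => (i \in S) ==> a)); last first.
  move=> x y; apply/fintype.subsetP/forallP => [h i|h i iS].
    by apply/implyP => /h; rewrite inE.
  by rewrite inE; have /implyP := h i; apply.
rewrite -prod_if_set; apply: eq_bigr => i _; rewrite sum_bool !sum_bool /=.
by case: ifP => _ /=; ring.
Qed.

Lemma nu_ones2 s S : nu s (fun _ y => S \subset ones y) = p ^+ #|S|.
Proof.
rewrite (@nu_prod _ _ (fun i _ b => (i \in S) ==> b)); last first.
  move=> x y; apply/fintype.subsetP/forallP => [h i|h i iS].
    by apply/implyP => /h; rewrite inE.
  by rewrite inE; have /implyP := h i; apply.
rewrite -prod_if_set; apply: eq_bigr => i _; rewrite sum_bool !sum_bool /=.
by case: ifP => _ /=; ring.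
Qed.

Lemma nu_ones12 s S : nu s (fun x y => (S \subset ones x) && (S \subset ones y))
  = (p * (expR (- s) + (1 - expR (- s)) * p)) ^+ #|S|.
Proof.
rewrite (@nu_prod _ _ (fun i a b => (i \in S) ==> (a && b))); last first.
  move=> x y; rewrite -finset.subsetI; apply/fintype.subsetP/forallP => [h i|h i iS].
    by apply/implyP => /h; rewrite !inE.
  by rewrite !inE; have /implyP := h i; apply.
rewrite -prod_if_set; apply: eq_bigr => i _; rewrite sum_bool !sum_bool /=.
by case: ifP => _ /=; ring.
Qed.

(** A set of ones survives if none of its clocks rings, which has probability
    [e^(-s |S|) >= 1 - s |S|]. *)
Lemma nu_diff_le s S : 0 <= s ->
  p ^+ #|S| - nu s (fun x y => (S \subset ones x) && (S \subset ones y)) <=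
  #|S|%:R * s * p ^+ #|S|.
Proof.
move=> s0; have /andP[e0 e1] := exp_range s0.
rewrite nu_ones12 exprMn -{1}[p ^+ _]mulr1 -mulrBr mulrC.
apply: ler_wpM2r; first exact: exprn_ge0.
rewrite lerBlDr -lerBlDl; apply: le_trans (_ : expR (- s) ^+ #|S| <= _).
  by rewrite -expRM_natl (le_trans _ (expR_ge1Dx _))// mulrN.
by rewrite lerXn2r ?nnegrE// ?addr_ge0 ?lerDl// mulr_ge0// subr_ge0.
Qed.

Lemma weight_split (T : finType) (w : T -> R) (E F : pred T) :
  \sum_(x | E x && ~~ F x) w x = \sum_(x | E x) w x - \sum_(x | E x && F x) w x.
Proof. by rewrite [X in _ = X - _](bigID F)/= addrAC subrr add0r. Qed.

(** Losing and gaining [S] have the same weight, both marginals of [nu] being stationary;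
    [nu_diff_le] bounds each, hence the factor 2. *)
Lemma nu_ones_change s S : 0 <= s ->
  nu s (fun x y => (S \subset ones x) != (S \subset ones y)) <=
    2 * (#|S|%:R * s * p ^+ #|S|).
Proof.
move=> s0; apply: le_trans (_ : nu s (fun x y => (S \subset ones x) && ~~ (S \subset ones y)) +
   nu s (fun x y => (S \subset ones y) && ~~ (S \subset ones x)) <= _); last first.
  have A1 := @weight_split _ (fun z : cube n * cube n => pi_meas p z.1 * trans_kernel p s z.1 z.2)
     (fun z => S \subset ones z.1) (fun z => S \subset ones z.2).
  have A2 := @weight_split _ (fun z : cube n * cube n => pi_meas p z.1 * trans_kernel p s z.1 z.2)
     (fun z => S \subset ones z.2) (fun z => S \subset ones z.1).
  have B := nu_diff_le S s0.
  have C1 := nu_ones1 s S; have C2 := nu_ones2 s S.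
  rewrite /nu in B C1 C2 *; rewrite A1 A2.
  under [X in _ + (_ - X)]eq_bigl do rewrite andbC.
  by rewrite C1 C2 mulr_natl mulr2n lerD.
rewrite /nu big_mkcond [X in _ <= X + _]big_mkcond [X in _ <= _ + X]big_mkcond.
rewrite -big_split; apply: ler_sum => z _ /=.
have := nu_weight_ge0 z s0; move: (_ * _) => w w0.
by case: (S \subset _); case: (S \subset _); rewrite /= ?addr0 ?add0r.
Qed.

Lemma mu_cylinder A S : S \subset A ->
  mu (fun x => ones x :&: A == S) = p ^+ #|S| * (1 - p) ^+ (#|A| - #|S|).
Proof.
move=> SA; rewrite (@mu_prod _ (fun i b => (i \in A) ==> (b == (i \in S)))); last first.
  move=> x; apply/eqP/forallP => [<- i|h].
    by apply/implyP => iA; rewrite !inE iA andbT.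
  apply/setP => i; rewrite !inE; have /implyP := h i.
  case: (boolP (i \in A)) => [_ /(_ isT)/eqP -> |iA _]; first by rewrite andbT.
  by rewrite andbF; apply/esym/negP => /(fintype.subsetP SA); rewrite (negPf iA).
have -> : (#|A| - #|S| = #|A :\: S|)%N.
  by rewrite cardsD (finset.setIidPr SA).
rewrite -!prod_if_set -big_split; apply: eq_bigr => i _; rewrite sum_bool /= inE.
case: (boolP (i \in S)) => [/(fintype.subsetP SA) ->|_] /=; first by ring.
by case: (i \in A) => /=; ring.
Qed.

End Cube.

(** * Crowded blocks: upper bounds, second-moment lower bound, forced switches *)

Section BlockEstimates.
Variables (R : realType) (n m : nat) (p : R).
Hypotheses (p01 : 0 <= p <= 1) (m0 : (0 < m)%N) (mn : (m %| n)%N).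
Local Notation b := (n %/ m)%N.
Implicit Types (r : nat) (s : R) (x y : cube n).

Let p0 : 0 <= p. Proof. by case/andP: p01. Qed.
Let p1 : 0 <= 1 - p. Proof. by rewrite subr_ge0; case/andP: p01. Qed.

(** Index set of the candidate witnesses. The predicate [P] is [predT] in the union bounds and omits
    one block in the Bonferroni argument. *)
Definition blkset (P : pred 'I_b) r (k : 'I_b * {set 'I_n}) :=
  P k.1 && ((k.2 \subset blk n m k.1) && (#|k.2| == r)).

Lemma sum_blkset P r (c : R) :
  \sum_(k | blkset P r k) c = (#|P| * 'C(m, r))%:R * c.
Proof.
rewrite /blkset -(pair_big_dep P (fun (j : 'I_b) (S : {set 'I_n}) =>
  (S \subset blk n m j) && (#|S| == r)) (fun _ _ => c))/=.
rewrite (eq_bigr (fun _ => 'C(m, r)%:R * c)) => [|j _]; last first.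
  rewrite sumr_const -[LHS]mulr_natl; congr (_%:R * _).
  rewrite -[in RHS](@card_blk n m m0 mn j (ltn_ord j)) -cards_draws -sum1_card.
  by rewrite -sum1_card; apply: eq_bigl => S; rewrite inE.
by rewrite sumr_const -[LHS]mulr_natl natrM mulrA.
Qed.

Lemma crowded_blkset r x : (0 < r)%N -> crowded m r x ->
  exists k, blkset predT r k && (k.2 \subset ones x).
Proof.
move=> r0 /(crowdedP m0 mn _ r0)[j [S [Sj Sr Sx]]].
by exists (j, S); rewrite /blkset /= Sj Sr eqxx Sx.
Qed.

Lemma blkset_crowded r x k : (0 < r)%N -> blkset predT r k -> k.2 \subset ones x ->
  crowded m r x.
Proof.
move=> r0; case: k => j S /= /andP[_ /andP[Sj /eqP Sr]] Sx.
by apply/(crowdedP m0 mn _ r0); exists j, S.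
Qed.

Lemma count_le r (c : R) : 0 <= c ->
  (b * 'C(m, r))%:R * (p ^+ r * c) <= b%:R * (m%:R * p) ^+ r * c.
Proof.
move=> c0; rewrite natrM exprMn -!mulrA; apply: ler_wpM2l => //.
apply: ler_wpM2r; first by rewrite mulr_ge0 ?exprn_ge0.
by rewrite -natrX ler_nat bin_le_exp.
Qed.

Lemma mu_crowded_le r : (0 < r)%N ->
  mu p (fun x : cube n => crowded m r x) <= b%:R * (m%:R * p) ^+ r.
Proof.
move=> r0.
have := @weight_union R _ _ _ (pi_meas_ge0 p01) (fun x => crowded m r x) (blkset predT r)
  (fun k x => k.2 \subset ones x) (fun x => @crowded_blkset r x r0).
move=> /le_trans; apply.
rewrite (eq_bigr (fun _ => p ^+ r * 1)) => [|k /andP[_ /andP[_ /eqP <-]]]; last first.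
  by rewrite mulr1; exact: mu_ones.
rewrite sum_blkset card_ord; apply: le_trans (count_le _ _) _ => //.
by rewrite mulr1.
Qed.

(** When crowding is lost, any witness of it at the earlier time is lost too, and symmetrically for
    a gain; so some candidate set changes status, and a union bound with [nu_ones_change]
    applies. *)
Lemma nu_crowded_change_le r s : (0 < r)%N -> 0 <= s ->
  nu p s (fun x y : cube n => crowded m r x != crowded m r y) <=
  b%:R * (m%:R * p) ^+ r * (2 * r%:R * s).
Proof.
move=> r0 s0.
have := @weight_union R (cube n * cube n)%type _ _
  (fun z => nu_weight_ge0 p01 z s0)
  (fun z => crowded m r z.1 != crowded m r z.2) (blkset predT r)
  (fun k z => (k.2 \subset ones z.1) != (k.2 \subset ones z.2)).
have h (z : cube n * cube n) : crowded m r z.1 != crowded m r z.2 ->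
    exists k, blkset predT r k && ((k.2 \subset ones z.1) != (k.2 \subset ones z.2)).
  case: z => x y /=; wlog xy : x y / crowded m r x && ~~ crowded m r y.
    move=> hw; case: (boolP (crowded m r x)) => dx; case: (boolP (crowded m r y)) => dy //= _.
      by apply: hw; rewrite ?dx ?dy.
    have [||k hk] := hw y x; first by rewrite dy dx.
      by rewrite (negPf dx) dy.
    by exists k; rewrite eq_sym.
  case/andP: xy => /(crowded_blkset r0)[k /andP[kQ kx]] dy _.
  exists k; rewrite kQ kx /=; apply: contra dy => /eqP/esym ky.
  exact: blkset_crowded ky.
move=> /(_ h)/le_trans; apply.
apply: le_trans (count_le _ _); last by rewrite !mulr_ge0.
rewrite -[in leRHS](card_ord b) -sum_blkset; apply: ler_sum => k /andP[_ /andP[_ /eqP kr]].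
have := nu_ones_change p01 k.2 s0; rewrite kr => /le_trans; apply.
by rewrite le_eqVlt; apply/orP; left; apply/eqP; ring.
Qed.

(* Bonferroni over the events that the ones of a block are exactly a given
   [r]-set: these are disjoint within a block and independent across blocks.
   The block of [i] is left out, so that [x i = 0] is independent of them. *)
Lemma mu_crowded_ge r (i : 'I_n) (L : R) : (0 < r)%N ->
  L = (b.-1 * 'C(m, r))%:R * (p ^+ r * (1 - p) ^+ (m - r)) ->
  (1 - p) * (L - L ^+ 2 / 2) <= mu p (fun x : cube n => crowded m r x && ~~ x i).
Proof.
move=> r0 LE.
pose q : R := p ^+ r * (1 - p) ^+ (m - r).
have q0 : 0 <= q by rewrite mulr_ge0 ?exprn_ge0.
have ib : (i %/ m < b)%N by rewrite ltn_divLR// divnK.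
pose P : pred 'I_b := predC1 (Ordinal ib).
have cP : #|P| = b.-1 by rewrite cardC1 card_ord.
pose F (k : 'I_b * {set 'I_n}) x := (ones x :&: blk n m k.1 == k.2) && ~~ x i.
have iB (j : 'I_b) : P j -> i \notin blk n m j.
  by move=> Pj; rewrite inE; apply: contra Pj => /eqP ij; apply/eqP/val_inj.
have F1 k : blkset P r k -> mu p (F k) = (1 - p) * q.
  case: k => j S /andP[/= Pj /andP[Sj /eqP Sr]].
  (* As [i] lies outside [S], the condition [x i = 0] is absorbed by enlarging the window with [i].
     The one extra zero produces the factor [1 - p]. *)
  have -> : mu p (F (j, S)) = mu p (fun x : cube n => ones x :&: (i |: blk n m j) == S).
    apply: eq_bigl => x; rewrite /F /= finset.setIUr; apply/andP/eqP => [[/eqP <- xi]|xS].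
      by apply/setP => k; rewrite !inE; have [->|_] := eqVneq k i; rewrite ?(negPf xi) ?andbF.
    have xi : ~~ x i.
      apply/negP => xi; have : i \in S by rewrite -xS !inE xi eqxx.
      by move/(fintype.subsetP Sj); rewrite (negPf (iB _ Pj)).
    split=> //; rewrite -xS; apply/eqP/setP => k; rewrite !inE.
    by have [->|_] := eqVneq k i; rewrite ?(negPf xi) ?andbF.
  rewrite mu_cylinder; last exact: fintype.subset_trans Sj (finset.subsetUr _ _).
  rewrite Sr cardsU1 iB// card_blk// /q mulrCA -exprS; congr (_ * _ ^+ _).
  have : (#|S| <= m)%N by rewrite -(card_blk m0 mn (ltn_ord j)) subset_leq_card.
  by rewrite Sr; lia.
have F2 k l : blkset P r k -> blkset P r l -> l != k ->
    mu p (fun x : cube n => F k x && F l x) <= (1 - p) * q ^+ 2.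
  case: k => j S /andP[/= Pj /andP[Sj /eqP Sr]].
  case: l => j' S' /andP[/= Pj' /andP[Sj' /eqP Sr']].
  have [->|jj _] := eqVneq j' j.
    rewrite xpair_eqE eqxx /= => SS; rewrite /mu big1 ?mulr_ge0 ?exprn_ge0// => x.
    rewrite /F /= => /andP[/andP[/eqP e1 _] /andP[/eqP e2 _]].
    by rewrite -e1 -e2 eqxx in SS.
  have dS : [disjoint blk n m j & blk n m j'] by apply: blk_disj; rewrite eq_sym.
  have dSS : [disjoint S & S'] by apply: disjointWl Sj _; apply: disjointWr Sj' _.
  rewrite le_eqVlt; apply/orP; left; apply/eqP.
  have -> : mu p (fun x : cube n => F (j, S) x && F (j', S') x) =
     mu p (fun x : cube n => ones x :&: (i |: (blk n m j :|: blk n m j')) == S :|: S').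
    apply: eq_bigl => x; rewrite /F /=; apply/idP/eqP => [|xS].
      move=> /andP[/andP[/eqP <- xi] /andP[/eqP <- _]].
      apply/setP => k; rewrite !inE; have [->|_] := eqVneq k i; rewrite ?(negPf xi)//.
      by case: (x k).
    have xi : ~~ x i.
      apply/negP => xi; have : i \in S :|: S' by rewrite -xS !inE xi eqxx.
      rewrite inE => /orP[/(fintype.subsetP Sj)|/(fintype.subsetP Sj')].
        by rewrite (negPf (iB _ Pj)).
      by rewrite (negPf (iB _ Pj')).
    have hx k : x k && ((k == i) || ((k \in blk n m j) || (k \in blk n m j'))) = (k \in S) || (k \in S').
      by move/setP: xS => /(_ k); rewrite !inE.
    rewrite xi !andbT; apply/andP; split; apply/eqP/setP => k.
      rewrite inE; case: (boolP (k \in blk n m j)) => kj.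
        have := hx k; rewrite kj orbT andbT inE => ->; rewrite andbT.
        case: (boolP (k \in S')) => [/(fintype.subsetP Sj') kj'|]; last by rewrite orbF.
        by have := disjointFr dS kj; rewrite kj'.
      by rewrite andbF; apply/esym/negP => /(fintype.subsetP Sj); rewrite (negPf kj).
    rewrite inE; case: (boolP (k \in blk n m j')) => kj.
      have := hx k; rewrite kj !orbT andbT inE => ->; rewrite andbT.
      case: (boolP (k \in S)) => [/(fintype.subsetP Sj) kj'|//].
      by have := disjointFr dS kj'; rewrite kj.
    by rewrite andbF; apply/esym/negP => /(fintype.subsetP Sj'); rewrite (negPf kj).
  rewrite mu_cylinder; last first.
    by apply: fintype.subset_trans (finset.subsetUr _ _); exact: finset.setUSS.
  rewrite cardsU1 inE negb_or !iB//.
  move: dSS dS; rewrite -!leq_card_setU => /eqP-> /eqP->.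
  rewrite Sr Sr' !card_blk// /q exprMn -!exprM mulrCA -exprS.
  have : (#|S| <= m)%N by rewrite -(card_blk m0 mn (ltn_ord j)) subset_leq_card.
  by rewrite Sr => rm; congr (_ ^+ _ * _ ^+ _); lia.
have := @weight_bonferroni R _ _ _ (pi_meas_ge0 p01) (fun x => crowded m r x && ~~ x i)
  (blkset P r) F.
have FD k x : blkset P r k -> F k x -> crowded m r x && ~~ x i.
  move=> /andP[_ kQ] /andP[/eqP xk ->]; rewrite andbT.
  by apply: (@blkset_crowded r x k r0); [exact: kQ|rewrite -xk finset.subsetIl].
move=> /(_ FD); apply: le_trans.
(* [L] is the number of candidate sets times [q], so the first-order sum is [(1 - p) L] and the sum
   over ordered pairs is at most [(1 - p) L^2]. *)
have S1 : \sum_(k | blkset P r k) \sum_(x | F k x) pi_meas p x = (1 - p) * L.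
  rewrite (eq_bigr _ F1) sum_blkset cP LE -/q; ring.
rewrite S1 mulrBr lerB// [leRHS]mulrA [leRHS]mulrC ler_pM2l ?invr_gt0 ?ltr0n//.
apply: le_trans (_ : \sum_(k | blkset P r k) ((1 - p) * q * L) <= _).
  apply: ler_sum => k kQ.
  apply: le_trans (_ : \sum_(l | blkset P r l) ((1 - p) * q ^+ 2) <= _).
    rewrite big_mkcondr; apply: ler_sum => l lQ; case: ifP => [lk|_].
      exact: F2.
    by rewrite mulr_ge0 ?exprn_ge0.
  by rewrite sum_blkset cP LE -/q le_eqVlt; apply/orP; left; apply/eqP; ring.
by rewrite sum_blkset cP LE -/q le_eqVlt; apply/orP; left; apply/eqP; ring.
Qed.

Definition flip (x : cube n) (i : 'I_n) : cube n :=
  [ffun j => if j == i then ~~ x j else x j].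

Lemma flip_inj x : injective (flip x).
Proof.
move=> i j /ffunP/(_ i); rewrite !ffunE eqxx.
by case: eqP => [//|_]; case: (x i).
Qed.

(** Adding a one keeps a crowded block crowded, so both values are parities, of counts that differ
    by one. *)
Lemma fblk_flip r x i : (0 < r)%N -> crowded m r.+1 x -> ~~ x i ->
  fblk m r x != fblk m r (flip x i).
Proof.
move=> r0 dx xi.
have oE : ones (flip x i) = i |: ones x.
  by apply/setP => j; rewrite !inE ffunE; case: eqP => [->|].
have dy : crowded m r.+1 (flip x i).
  move: dx => /(crowded_blkset (ltn0Sn r))[k /andP[kQ kx]].
  apply: blkset_crowded kQ _ => //; rewrite oE.
  exact: fintype.subset_trans kx (finset.subsetUr _ _).
rewrite /fblk dx dy oE cardsU1 inE xi /=.
by case: (odd _).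
Qed.

(** One way to make the move: the clock of [i] rings with outcome one and all others stay silent.
    The exponent [n] in place of [n - 1] is a harmless loss. *)
Lemma trans_kernel_flip s x i : 0 <= s -> ~~ x i ->
  expR (- s) ^+ n * ((1 - expR (- s)) * p) <= trans_kernel p s x (flip x i).
Proof.
move=> s0 xi; have /andP[e0 e1] := exp_range s0.
have n0 : (0 < n)%N by case: (n) i x xi => [[]|].
rewrite /trans_kernel (bigD1 i)//= mulrC; apply: ler_pM.
- by rewrite mulr_ge0// subr_ge0.
- exact: exprn_ge0.
- by rewrite ffunE eqxx (negPf xi) /= mulr0 add0r.
apply: le_trans (_ : expR (- s) ^+ n.-1 <= _).
  by rewrite -{1}(prednK n0) exprS ler_piMl ?exprn_ge0.
rewrite -[X in _ ^+ X.-1]card_ord -(cardC1 i) -prodr_const; apply: ler_prod => j ji.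
rewrite e0 ffunE; rewrite !inE in ji; rewrite (negPf ji).
by have := step_ge p01 (x j) (x j) s0; rewrite eqxx mulr1.
Qed.

(** Only moves to a single flip are kept. For a fixed starting point the targets are distinct by
    [flip_inj], so the contributions of the coordinates add up. *)
Lemma nu_fblk_ge r s : (0 < r)%N -> 0 <= s ->
  expR (- s) ^+ n * ((1 - expR (- s)) * p) *
    \sum_i mu p (fun x : cube n => crowded m r.+1 x && ~~ x i) <=
  nu p s (fun x y : cube n => fblk m r x != fblk m r y).
Proof.
move=> r0 s0; have w0 (z : cube n * cube n) := nu_weight_ge0 p01 z s0.
set c := _ * (_ * p).
have -> : nu p s (fun x y : cube n => fblk m r x != fblk m r y) =
    \sum_(x : cube n) \sum_(y : cube n) if fblk m r x != fblk m r y
      then pi_meas p x * trans_kernel p s x y else 0.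
  by rewrite pair_bigA /nu big_mkcond.
rewrite mulr_sumr /mu; under eq_bigr do rewrite big_mkcond mulr_sumr.
rewrite exchange_big; apply: ler_sum => x _.
apply: le_trans (_ : \sum_(y in flip x @: [set: 'I_n]%SET)
   (if fblk m r x != fblk m r y then pi_meas p x * trans_kernel p s x y else 0) <= _); last first.
  by rewrite big_mkcond; apply: ler_sum => y _; have /= := w0 (x, y); case: ifP; case: ifP.
rewrite big_imset; last by move=> ? ? _ _; exact: flip_inj.
apply: le_trans (_ : \sum_i (if fblk m r x != fblk m r (flip x i)
  then pi_meas p x * trans_kernel p s x (flip x i) else 0) <= _); last first.
  by rewrite le_eqVlt; apply/orP; left; apply/eqP/eq_bigl => i; rewrite finset.in_setT.
apply: ler_sum => i _; case: ifPn => [/andP[dx xi]|_]; last first.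
  by rewrite mulr0; have /= := w0 (x, flip x i); case: ifP.
rewrite fblk_flip// mulrC; apply: ler_wpM2l; first exact: pi_meas_ge0.
exact: trans_kernel_flip.
Qed.

End BlockEstimates.

Local Open Scope classical_set_scope.

(** * From grid counts to the switch count *)

Section SequenceLimits.
Variable R : realType.
Implicit Type u : nat -> \bar R.

Lemma cvg_einf_esup u : limn_einf u = limn_esup u -> cvgn u.
Proof.
rewrite limn_esup_lim limn_einf_lim => e.
apply/cvg_ex; exists (limn (esups u)).
apply: (@squeeze_cvge _ _ _ _ (einfs u) u (esups u)).
- near=> k; rewrite /einfs /esups /sdrop; apply/andP; split.
    by apply: ereal_inf_lbound; exists k => /=.
  by apply: ereal_sup_ubound; exists k => /=.
- by rewrite -e; exact: is_cvg_einfs.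
- exact: is_cvg_esups.
Unshelve. all: by end_near. Qed.

(** Convergence is not assumed: where the lower and upper limits agree the limit is the upper one,
    and on the complement, also measurable, [limn] is the constant [point]. *)
Lemma measurable_limn d (T : measurableType d) (h : nat -> T -> \bar R) :
  (forall k, measurable_fun [set: T] (h k)) ->
  measurable_fun [set: T] (fun w => limn (h ^~ w)).
Proof.
move=> mh.
have me : measurable_fun [set: T] (fun w => limn_esup (h ^~ w)).
  exact: measurable_fun_limn_esup.
have mi : measurable_fun [set: T] (fun w => limn_einf (h ^~ w)).
  apply: measurableT_comp => //; apply: measurable_fun_limn_esup => k.
  exact: measurableT_comp.
have mE : measurable [set w | limn_einf (h ^~ w) = limn_esup (h ^~ w)].
  by rewrite -[X in measurable X]setTI; exact: measurable_eqe.
rewrite (_ : (fun w => _) = fun w =>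
  if limn_einf (h ^~ w) == limn_esup (h ^~ w) then limn_esup (h ^~ w) else point).
  apply: measurable_fun_if => //.
  - apply: (measurable_fun_bool true); rewrite setTI.
    rewrite (_ : _ @^-1` _ = [set w | limn_einf (h ^~ w) = limn_esup (h ^~ w)])//.
    by apply/seteqP; split => w /= /eqP.
  - exact: measurable_funTS.
apply/funext => w; case: eqP => [e|ne].
  by rewrite is_cvg_limn_esupE//; exact: cvg_einf_esup.
rewrite dvgP// => c; apply: ne.
by rewrite is_cvg_limn_einfE// is_cvg_limn_esupE.
Qed.

Lemma limn_ge_near (u : nat -> nat) (k : nat) : (0 < k)%N ->
  (k%:R%:E <= limn (fun N => (u N)%:R%:E : \bar R))%E ->
  exists M, forall N, (M <= N)%N -> (k <= u N)%N.
Proof.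
move=> k0 kl.
have [c|/dvgP e] := pselect (cvgn (fun N => (u N)%:R%:E : \bar R)); last first.
  by move: kl; rewrite e lee_fin lern0; case: (k) k0.
(* The counts are integers, so eventually exceeding [k - 1/2] is the same as eventually reaching
   [k]. *)
have : \forall N \near \oo, ((k%:R - 2^-1)%:E < ((u N)%:R%:E : \bar R))%E.
  have h : nbhs (limn (fun N => (u N)%:R%:E : \bar R))
      [set y : \bar R | ((k%:R - 2^-1)%:E < y)%E].
    apply: open_nbhs_nbhs; split=> /=; first exact: open_ereal_gt_ereal.
    by apply: lt_le_trans kl; rewrite lte_fin ltrBlDr ltrDl.
  exact: (c _ h).
move=> [M _ HM]; exists M => N /HM /=; rewrite lte_fin => h.
have : k%:R < (u N).+1%:R :> R by rewrite -natr1; lra.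
by rewrite ltr_nat ltnS.
Qed.

(** If each value is eventually dominated, the lower limit is at least the supremum, so the sequence
    converges to it in the extended reals. This replaces monotonicity, since grids of different
    sizes are not nested. *)
Lemma le_limn (u : nat -> nat) :
  (forall M, exists N0, forall N, (N0 <= N)%N -> (u M <= u N)%N) ->
  forall M, ((u M)%:R%:E <= limn (fun N => (u N)%:R%:E : \bar R))%E.
Proof.
move=> hu.
have c : cvgn (fun N => (u N)%:R%:E : \bar R).
  apply: cvg_einf_esup; apply/eqP; rewrite eq_le limn_einf_sup/=.
  rewrite limn_esup_lim limn_einf_lim.
  apply: (@le_trans _ _ (ereal_sup (range (fun N => (u N)%:R%:E : \bar R)))).
    apply: lime_le; first exact: is_cvg_esups.
    near=> N; apply: ge_ereal_sup => _ [k _ <-].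
    by apply: ereal_sup_ubound; exists k.
  apply: ge_ereal_sup => _ [M _ <-].
  have [N0 hN0] := hu M.
  apply: lime_ge; first exact: is_cvg_einfs.
  exists N0 => // N NN; apply: le_ereal_inf_tmp => _ [k kN <-].
  by rewrite lee_fin ler_nat hN0//; apply: leq_trans NN kN.
move=> M; have [N0 hN0] := hu M; apply: lime_ge => //.
by exists N0 => // N NN; rewrite lee_fin ler_nat hN0.
Unshelve. all: by end_near. Qed.

End SequenceLimits.

Section FinitelyValued.
Context {R : realType} {d : measure_display} {Omega : measurableType d}.
Variables (P : probability Omega R) (T : finType).

Lemma prob_fin_bigcup (F : T -> set Omega) :
  (forall y, measurable (F y)) -> (forall y z w, F y w -> F z w -> y = z) ->
  P (\bigcup_y F y) = (\sum_y P (F y))%E.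
Proof.
move=> mF dF; rewrite measure_fin_bigcup//; last first.
  by move=> y z _ _ [w [yw zw]]; apply: dF yw zw.
  exact: finite_finset.
rewrite [RHS]fsbig_seq ?index_enum_uniq//.
rewrite (_ : [set` index_enum T] = setT)//.
by apply/seteqP; split => // y _; exact: mem_index_enum.
Qed.

Variable Y : Omega -> T.
Hypothesis mY : forall y, measurable [set w | Y w = y].

Lemma measurable_fin_pred (E : pred T) : measurable [set w | E (Y w)].
Proof.
rewrite (_ : [set w | _] = \bigcup_(y in [set y | E y]) [set w | Y w = y]).
  by apply: fin_bigcup_measurable.
apply/seteqP; split => w /=; first by move=> EY; exists (Y w).
by move=> [y /= Ey ->].
Qed.

Lemma prob_fin_pred (E : pred T) (c : T -> R) :
  (forall y, P [set w | Y w = y] = (c y)%:E) ->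
  P [set w | E (Y w)] = (\sum_(y | E y) c y)%:E.
Proof.
move=> Pc.
rewrite (_ : [set w | _] = \bigcup_y [set w | Y w = y /\ E y]).
  have h y : [set w | Y w = y /\ E y] = if E y then [set w | Y w = y] else set0.
    by apply/seteqP; split => w /=; case: (E y) => //= -[].
  rewrite prob_fin_bigcup.
  - rewrite -sumEFin [RHS]big_mkcond; apply: eq_bigr => y _; rewrite h -Pc.
    by case: ifP => // _; rewrite measure0.
  - by move=> y; rewrite h; case: ifP.
  - by move=> y z w /= [<- _] [<- _].
apply/seteqP; split => w /=; first by move=> EY; exists (Y w).
by move=> [y _ [->]].
Qed.

End FinitelyValued.

Section GridRefinement.

Lemma change_le_sum (v : nat -> bool) a b : (a <= b)%N ->
  ((v a != v b) <= \sum_(a <= l < b) (v l != v l.+1))%N.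
Proof.
move=> /subnKC <-; elim: (b - a)%N => [|k IH]; first by rewrite addn0 eqxx.
rewrite addnS big_nat_recr ?leq_addr//=.
by move: IH; case: (v a); case: (v _); case: (v _) => /=; lia.
Qed.

Lemma sum_refine (F : nat -> nat) (h : nat -> nat) M : h 0%N = 0%N ->
  (forall i, h i <= h i.+1)%N ->
  (\sum_(i < M) \sum_(h i <= l < h i.+1) F l = \sum_(0 <= l < h M) F l)%N.
Proof.
move=> h0 hS; elim: M => [|M IH]; first by rewrite big_ord0 h0 big_geq.
by rewrite big_ord_recr/= IH -big_cat_nat.
Qed.

End GridRefinement.

(** * Grid counts and switch counts of the process *)

Section Process.
Context {R : realType} {d : measure_display} {Omega : measurableType d}.
Variables (P : probability Omega R) (n : nat) (p : R) (X : R -> Omega -> cube n).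
Hypothesis hX : biased_rw P p X.

Lemma measurable_state t x : measurable [set w | X t w = x].
Proof. by case: hX => + _; exact. Qed.

Lemma measurable_states s t (z : cube n * cube n) :
  measurable [set w | (X s w, X t w) = z].
Proof.
rewrite (_ : [set w | _] = [set w | X s w = z.1] `&` [set w | X t w = z.2]).
  by apply: measurableI; exact: measurable_state.
by apply/seteqP; split => w /=; [move=> <-|case: z => x y /= [-> ->]].
Qed.

Lemma measurable_rel s t (E : rel (cube n)) : measurable [set w | E (X s w) (X t w)].
Proof.
exact: (@measurable_fin_pred _ _ _ (fun w => (X s w, X t w)) (measurable_states s t)
  (fun z => E z.1 z.2)).
Qed.

Lemma measurable_pred t (E : pred (cube n)) : measurable [set w | E (X t w)].
Proof. exact: (measurable_rel t t (fun x _ => E x)). Qed.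

Lemma prob_mu t (E : pred (cube n)) : 0 <= t -> P [set w | E (X t w)] = (mu p E)%:E.
Proof.
move=> t0; apply: prob_fin_pred; first exact: measurable_state.
move=> x; case: hX => _ /(_ 0%N (fun=> t) (fun=> x)).
rewrite big_ord0 mulr1 => <- //.
by congr (P _); apply/seteqP; split => w /= => [xw j _ //|/(_ 0%N)]; exact.
Qed.

Lemma prob_nu s t (E : rel (cube n)) : 0 <= s -> s <= t ->
  P [set w | E (X s w) (X t w)] = (nu p (t - s) E)%:E.
Proof.
move=> s0 st.
apply: (@prob_fin_pred _ _ _ P _ (fun w => (X s w, X t w)) (measurable_states s t)
  (fun z => E z.1 z.2)).
move=> [x y]; case: hX => _ /(_ 1%N (fun j => if j is 0%N then s else t)
  (fun j => if j is 0%N then x else y)).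
rewrite big_ord1/= => <- //.
  congr (P _); apply/seteqP; split => w /= => [[<- <-] [|[|//]]//|h].
  by have /= -> := h 0%N isT; have /= -> := h 1%N isT.
by case.
Qed.

Definition grid_step (f : cube n -> bool) N i :=
  [set w | f (X (i%:R / N%:R) w) != f (X (i.+1%:R / N%:R) w)].

Lemma measurable_grid_step f N i : measurable (grid_step f N i).
Proof. exact: (measurable_rel _ _ (fun x y => f x != f y)). Qed.

Lemma prob_grid_step f N i : P (grid_step f N i) = (nu p N%:R^-1 (fun x y => f x != f y))%:E.
Proof.
rewrite /grid_step (@prob_nu _ _ (fun x y => f x != f y)) ?divr_ge0//; last first.
  by rewrite ler_wpM2r ?invr_ge0// ler_nat.
by rewrite -mulrBl -natr1 addrAC subrr add0r mul1r.
Qed.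

Definition grid_fun f N (w : Omega) : \bar R := ((grid_changes f X N w)%:R)%:E.

Lemma grid_funE f N : grid_fun f N = fun w => (\sum_(i < N) (\1_(grid_step f N i) w)%:E)%E.
Proof.
apply/funext => w; rewrite /grid_fun /grid_changes natr_sum -sumEFin.
apply: eq_bigr => i _; rewrite indicE; congr (_%:R%:E); congr nat_of_bool.
by apply/esym; rewrite /grid_step; apply/idP/idP; rewrite inE.
Qed.

Lemma measurable_grid_fun f N : measurable_fun [set: Omega] (grid_fun f N).
Proof.
rewrite grid_funE; apply: emeasurable_sum => i.
apply/measurable_EFinP; apply: measurable_indic; exact: measurable_grid_step.
Qed.

Lemma integral_grid_fun f N :
  (\int[P]_w grid_fun f N w = (N%:R * nu p N%:R^-1 (fun x y => f x != f y))%:E)%E.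
Proof.
rewrite grid_funE ge0_integral_sum//; last first.
  move=> i; apply/measurable_EFinP; apply: measurable_indic; exact: measurable_grid_step.
rewrite (eq_bigr (fun=> (nu p N%:R^-1 (fun x y => f x != f y))%:E)) => [|i _]; last first.
  by rewrite integral_indic ?setIT //; [exact: prob_grid_step|exact: measurable_grid_step].
by rewrite sumEFin sumr_const card_ord mulr_natl.
Qed.

Lemma measurable_grid_ge f N (k : nat) : measurable [set w | (k <= grid_changes f X N w)%N].
Proof.
rewrite (_ : [set w | _] = setT `&` [set w | (k%:R%:E <= grid_fun f N w)%E]).
  by apply: emeasurable_fun_c_infty => //; exact: measurable_grid_fun.
by apply/seteqP; split => w /=; rewrite ?lee_fin ?ler_nat// => -[].
Qed.

Lemma prob_grid_ge f N (k : nat) :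
  (k%:R%:E * P [set w | (k <= grid_changes f X N w)%N] <=
   (N%:R * nu p N%:R^-1 (fun x y => f x != f y))%:E)%E.
Proof.
rewrite -integral_grid_fun -[P _](_ : \int[P]_w (\1_[set w | (k <= grid_changes f X N w)%N] w)%:E = _)%E; last first.
  by rewrite integral_indic ?setIT//; exact: measurable_grid_ge.
rewrite -ge0_integralZl_EFin//; last first.
  apply/measurable_EFinP; apply: measurable_indic; exact: measurable_grid_ge.
apply: ge0_le_integral => //.
- apply/measurable_EFinP; apply: measurable_funM => //.
  by apply: measurable_indic; exact: measurable_grid_ge.
- exact: measurable_grid_fun.
move=> w _; rewrite lee_fin indicE.
by case: (boolP (w \in _)) => [|_]; rewrite ?inE/= ?mulr1 ?mulr0 ?ler_nat.
Qed.

(** Along the grid [A] can occur only if it holds at time 0 or changes status across some step.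
    Outside these events [f] and [g] have the same count. *)
Lemma prob_grid_tail (f g A : pred (cube n)) N (k : nat) :
  (forall x, ~~ A x -> f x = g x) ->
  (P [set w | (k <= grid_changes f X N w)%N] <=
    (mu p A + N%:R * nu p N%:R^-1 (fun x y => A x != A y))%:E +
    P [set w | (k <= grid_changes g X N w)%N])%E.
Proof.
move=> fg; pose U := [set w | A (X 0 w)] `|` \big[setU/set0]_(i < N) grid_step A N i.
have mU : measurable U.
  apply: measurableU; first exact: measurable_pred.
  by apply: bigsetU_measurable => i _; exact: measurable_grid_step.
have UE : (P U <= (mu p A + N%:R * nu p N%:R^-1 (fun x y => A x != A y))%:E)%E.
  apply: le_trans (measureU2 _ _ _) _ => //; first exact: measurable_pred.
    by apply: bigsetU_measurable => i _; exact: measurable_grid_step.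
  have PA : P [set w | A (X 0 w)] = (mu p A)%:E := prob_mu A (lexx 0).
  rewrite EFinD; apply: leeD; first by rewrite -PA.
  apply: le_trans (Boole_inequality _ _) _.
    by move=> i _; exact: measurable_grid_step.
  rewrite (eq_bigr (fun=> (nu p N%:R^-1 (fun x y => A x != A y))%:E)) => [|i _]; last first.
    exact: prob_grid_step.
  by rewrite sumEFin sumr_const card_ord mulr_natl.
apply: le_trans (leeD2r _ UE).
apply: le_trans (measureU2 _ _ _) => //; last exact: measurable_grid_ge.
apply: le_measure; rewrite ?inE; first exact: measurable_grid_ge.
  by apply: measurableU => //; exact: measurable_grid_ge.
move=> w /= kw; have [Uw|nU] := pselect (U w); [by left|right].
have nA i : (i <= N)%N -> ~~ A (X (i%:R / N%:R) w).
  elim: i => [|i IH] iN; first by rewrite mul0r; apply/negP => A0; apply: nU; left.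
  apply/negP => Ai; apply: nU; right; rewrite -bigcup_mkord; exists i => //=.
  by rewrite /grid_step /= Ai (negPf (IH (ltnW iN))).
move: kw; rewrite /grid_changes => /leq_trans; apply.
by apply: leq_sum => i _; rewrite !fg// nA// ltnW.
Qed.

Lemma switch_countE f : switch_count f X = fun w => limn (grid_fun f ^~ w).
Proof. by []. Qed.

Lemma measurable_switch_count f : measurable_fun [set: Omega] (switch_count f X).
Proof.
by rewrite switch_countE; apply: measurable_limn => N; exact: measurable_grid_fun.
Qed.

(* [k > 0] matters: where the grid counts do not converge, [limn] is the junk
   value [0], which then does not reach [k]. *)
Lemma prob_switch_tail f (k : nat) (c : R) : (0 < k)%N ->
  (forall N, (0 < N)%N -> P [set w | (k <= grid_changes f X N w)%N] <= c%:E)%E ->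
  (P [set w | (k%:R%:E <= switch_count f X w)%E] <= c%:E)%E.
Proof.
move=> k0 hc.
(* The strict [M < N] keeps [N] positive, as [hc] requires. The sets increase with [M], and each has
   probability at most [c] because it lies in the event for [N = M + 1]. *)
pose F M := \bigcap_(N in [set N | (M < N)%N]) [set w | (k <= grid_changes f X N w)%N].
have mF M : measurable (F M).
  by apply: bigcap_measurable => [|N _]; [exists M.+1 => /=|exact: measurable_grid_ge].
apply: (@le_trans _ _ (P (\bigcup_M F M))).
  apply: le_measure; rewrite ?inE.
  - rewrite -[X in measurable X]setTI; apply: emeasurable_fun_c_infty => //.
    exact: measurable_switch_count.
  - exact: bigcup_measurable.
  move=> w /= /(limn_ge_near k0)[M hM]; exists M => // N /= MN.
  by apply: hM; exact: ltnW.
have cv := @nondecreasing_cvg_mu _ _ _ P F mF (bigcup_measurable (fun k _ => mF k)).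
have /cv{}cv : {homo F : M N / (M <= N)%N >-> (M <= N)%O}.
  move=> M N MN; apply/subsetPset => w FM K /= NK; apply: FM.
  exact: leq_ltn_trans MN NK.
rewrite -(cvg_lim _ cv)//; apply: lime_le; first by apply/cvg_ex; eexists; exact: cv.
near=> M; apply: le_trans (hc M.+1 _) => //.
apply: le_measure; rewrite ?inE//; first exact: measurable_grid_ge.
by move=> w /(_ M.+1); apply => /=.
Unshelve. all: by end_near. Qed.

End Process.

(** * Almost sure convergence of the grid counts *)

Section RightConstancy.
Context {R : realType} {d : measure_display} {Omega : measurableType d}.
Variables (P : probability Omega R) (n : nat) (p : R) (X : R -> Omega -> cube n).
Hypotheses (p01 : 0 <= p <= 1) (hX : biased_rw P p X).

(* The paths of [X] need not be right-continuous, as only its finite-dimensional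
   laws are prescribed; right-constancy along the rationals is what survives.
   The meshes of step [1 / (k! L)] are nested in [k] and exhaust the rationals
   of [q, q + 1/L]. *)
Definition mesh (q : R) (L k j : nat) : R := q + j%:R / (k`! * L)%:R.

Definition stay q L k := [set w | forall j, (j <= k`!)%N -> X (mesh q L k j) w = X q w].

Definition right_const (q : R) := \bigcup_(L in [set L | (0 < L)%N]) \bigcap_k stay q L k.

Lemma mesh0 q L k : mesh q L k 0 = q.
Proof. by rewrite /mesh mul0r addr0. Qed.

Lemma stay_bigcup q L k :
  stay q L k = \bigcup_x [set w | forall j, (j <= k`!)%N -> X (mesh q L k j) w = x].
Proof.
apply/seteqP; split => w /=; first by move=> h; exists (X q w).
by move=> [x _ /= h] j /h ->; have := h 0%N isT; rewrite mesh0.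
Qed.

Lemma measurable_mesh_eq q L k x :
  measurable [set w | forall j, (j <= k`!)%N -> X (mesh q L k j) w = x].
Proof.
rewrite (_ : [set w | _] = \bigcap_(j in [set j | (j <= k`!)%N]) [set w | X (mesh q L k j) w = x]).
  by apply: bigcap_measurable => [|j _]; [exists 0%N|exact: (measurable_state hX)].
by apply/seteqP; split => w /= h j; [move=> /h|move=> /h].
Qed.

Lemma measurable_stay q L k : measurable (stay q L k).
Proof.
rewrite stay_bigcup; apply: fin_bigcup_measurable; first exact: finite_finset.
by move=> x _; exact: measurable_mesh_eq.
Qed.

Lemma sum_pi : \sum_(x : cube n) pi_meas p x = 1.
Proof.
have := mu_ones p (@finset.set0 'I_n); rewrite cards0 expr0 => <-.
by apply: eq_bigl => x; rewrite finset.sub0set.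
Qed.

(** Remaining in place over all [k!] mesh steps has probability at least [e^(-n / L) >= 1 - n / L].
    This does not depend on [k], so it passes to the intersection over all meshes. *)
Lemma prob_stay q L k : 0 <= q -> (0 < L)%N ->
  ((1 - n%:R / L%:R)%:E <= P (stay q L k))%E.
Proof.
move=> q0 L0; rewrite stay_bigcup prob_fin_bigcup; last first.
- by move=> y z w /= /(_ 0%N isT) <- /(_ 0%N isT) <-.
- by move=> x; exact: measurable_mesh_eq.
have kL : 0 < (k`! * L)%:R :> R by rewrite ltr0n muln_gt0 fact_gt0.
pose s : R := (k`! * L)%:R^-1.
have s0 : 0 <= s by rewrite invr_ge0 ltW.
have meshS j : mesh q L k j.+1 - mesh q L k j = s.
  by rewrite /mesh opprD addrACA subrr add0r -mulrBl -natr1 addrAC subrr add0r mul1r.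
have -> : (1 - n%:R / L%:R)%:E = (\sum_(x : cube n) (pi_meas p x * (1 - n%:R / L%:R))%:E)%E.
  by rewrite sumEFin -mulr_suml sum_pi mul1r.
apply: lee_sum => x _; have [_ ->] := hX; last 2 first.
- by rewrite mesh0.
- by move=> j; rewrite -subr_ge0 meshS.
rewrite lee_fin ler_wpM2l ?pi_meas_ge0//.
apply: (@le_trans _ _ ((expR (- s) ^+ n) ^+ k`!)); last first.
  rewrite -[X in _ ^+ X](card_ord k`!) -prodr_const; apply: ler_prod => j _.
  by rewrite exprn_ge0 ?expR_ge0//= meshS trans_kernel_refl.
rewrite -exprM -expRM_natl (le_trans _ (expR_ge1Dx _))// lerD2l mulrN lerN2.
have -> // : (n * k`!)%:R * s = n%:R / L%:R.
rewrite /s !natrM; field.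
by rewrite !pnatr_eq0 -!lt0n L0 fact_gt0.
Qed.

Lemma stay_nonincreasing q L : {homo stay q L : k l / (k <= l)%N >-> (l <= k)%O}.
Proof.
move=> k l kl; apply/subsetPset => w h j jk.
have /dvdnP[c cE] : (k`! %| l`!)%N.
  elim: l kl {h} => [|l IH]; first by rewrite leqn0 => /eqP->.
  rewrite leq_eqVlt => /orP[/eqP->//|/IH]; rewrite factS; exact: dvdn_mull.
have c0 : (0 < c)%N.
  by rewrite lt0n; apply/eqP => c0; have := fact_gt0 l; rewrite cE c0.
rewrite -(h (c * j)%N); last by rewrite cE leq_mul2l jk orbT.
congr (X _ w); rewrite /mesh cE; congr (_ + _).
rewrite -mulnA 2!(natrM _ c) -mulf_div mulfV ?mul1r//.
by rewrite pnatr_eq0 -lt0n.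
Qed.

Lemma right_const_ae q : 0 <= q -> P.-negligible (~` right_const q).
Proof.
move=> q0.
have mS L : measurable (\bigcap_k stay q L k).
  by apply: bigcap_measurable => [|k _]; [exists 0%N|exact: measurable_stay].
have mR : measurable (right_const q) by apply: bigcup_measurable.
apply/negligibleP; first exact: measurableC.
have ge L : (0 < L)%N -> ((1 - n%:R / L%:R)%:E <= P (right_const q))%E.
  move=> L0; apply: (@le_trans _ _ (P (\bigcap_k stay q L k))); last first.
    by apply: le_measure; rewrite ?inE//; move=> w hw; exists L.
  have cv : P (stay q L k) @[k --> \oo] --> P (\bigcap_k stay q L k).
    apply: nonincreasing_cvg_mu => //.
    - by rewrite (le_lt_trans (probability_le1 _ _)) ?ltry//; exact: measurable_stay.
    - by move=> k; exact: measurable_stay.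
    - exact: stay_nonincreasing.
  rewrite -(cvg_lim _ cv)//; apply: lime_ge; first by apply/cvg_ex; eexists; exact: cv.
  by near=> k; exact: prob_stay.
transitivity (1 - P (right_const q))%E; first exact: probability_setC.
suff -> : P (right_const q) = 1%E by rewrite subee.
apply/eqP; rewrite eq_le probability_le1//=.
apply/lee_addgt0Pr => e e0.
pose L := (Num.truncn (n%:R / e)).+1.
apply: (@le_trans _ _ ((1 - n%:R / L%:R)%:E + e%:E)%E); last exact: leeD2r (ge _ _).
rewrite -EFinD lee_fin addrAC -addrA lerDl subr_ge0.
have : n%:R / e < L%:R by exact: truncnS_gt.
by rewrite ltr_pdivrMr// ler_pdivrMr ?ltr0n// mulrC => /ltW.
Unshelve. all: by end_near. Qed.

Lemma right_constP q w : right_const q w -> exists L, (0 < L)%N /\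
  forall M N i i', (0 < M)%N -> (0 < N)%N -> q = i%:R / M%:R ->
    q <= i'%:R / N%:R <= q + L%:R^-1 ->
    X (i'%:R / N%:R) w = X q w.
Proof.
move=> [L L0 h]; exists L; split => // M N i i' M0 N0 qE /andP[].
rewrite qE => lo hi; rewrite -qE.
have M0R : 0 < M%:R :> R by rewrite ltr0n.
have N0R : 0 < N%:R :> R by rewrite ltr0n.
have L0R : 0 < L%:R :> R by rewrite ltr0n.
have NMn : (0 < N * M)%N by rewrite muln_gt0 N0.
(* Take the mesh with [k = N * M]: the difference of [i' / N] and [i / M] has denominator [N * M],
   which divides [k!], so [i' / N] is a mesh point. *)
have /dvdnP[c cE] : (N * M %| (N * M)`!)%N by apply: dvdn_fact; rewrite NMn leqnn.
have lo' : (i * N <= i' * M)%N.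
  by move: lo; rewrite ler_pdivrMr// mulrAC ler_pdivlMr// -!natrM ler_nat.
pose j := ((i' * M - i * N) * L * c)%N.
have jE : mesh q L (N * M) j = i'%:R / N%:R.
  rewrite /mesh qE cE /j !natrM natrB// !natrM.
  have c0 : (0 < c)%N.
    by rewrite lt0n; apply/eqP => c0; have := fact_gt0 (N * M); rewrite cE c0.
  have c0R : 0 < c%:R :> R by rewrite ltr0n.
  by field; rewrite !gt_eqF.
rewrite -jE; apply: h => //=; rewrite cE /j mulnC leq_mul2l; apply/orP; right.
move: hi; rewrite -lerBlDl -(ler_nat R) !natrM natrB// !natrM => hi.
have -> : (i'%:R * M%:R - i%:R * N%:R) * L%:R =
   (i'%:R / N%:R - i%:R / M%:R) * (N%:R * M%:R * L%:R) :> R.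
  by field; rewrite !gt_eqF.
apply: le_trans (_ : L%:R^-1 * (N%:R * M%:R * L%:R) <= _).
  by apply: ler_wpM2r => //; rewrite !mulr_ge0.
by rewrite mulrCA mulVf ?gt_eqF// mulr1.
Qed.

(** Each point [i / M] is replaced by the next point of the [N]-grid, at distance less than [1 / N];
    for large [N] right-constancy makes the states equal. A change across a coarse step then forces
    one between the corresponding fine points. *)
Lemma grid_refine f w M : (forall N i, right_const (i%:R / N%:R) w) ->
  exists N0, forall N, (N0 <= N)%N ->
    (grid_changes f X M w <= grid_changes f X N w)%N.
Proof.
move=> rc; case: (posnP M) => [->|M0].
  by exists 0%N => N _; rewrite /grid_changes big_ord0.
have [Lf hL] := choice (fun i => right_constP (rc M i)).
pose N0 := (\sum_(i < M.+1) Lf i)%N; exists N0 => N NN.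
have Lle i : (i <= M)%N -> (Lf i <= N)%N.
  move=> iM; apply: leq_trans NN; rewrite /N0.
  by rewrite (bigD1 (Ordinal (iM : (i < M.+1)%N)))//= leq_addr.
have N0' : (0 < N)%N by apply: leq_trans (Lle 0%N _) => //; exact: (hL 0%N).1.
(* [h i / N] is the first point of the [N]-grid after [i / M]. *)
pose h i := ((i * N + M.-1) %/ M)%N.
have hlo i : (i * N <= h i * M)%N.
  have := divn_eq (i * N + M.-1) M; have := ltn_pmod (i * N + M.-1) M0.
  rewrite -/(h i); lia.
have hhi i : (h i * M <= i * N + M.-1)%N by exact: leq_trunc_div.
have hX' i : (i <= M)%N -> X ((h i)%:R / N%:R) w = X (i%:R / M%:R) w.
  move=> iM; have [L0 hq] := hL i; apply: (hq M N i (h i)) => //.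
  have M0R : 0 < M%:R :> R by rewrite ltr0n.
  have N0R : 0 < N%:R :> R by rewrite ltr0n.
  have L0R : 0 < (Lf i)%:R :> R by rewrite ltr0n.
  apply/andP; split.
    by rewrite ler_pdivrMr// mulrAC ler_pdivlMr// -!natrM ler_nat.
  apply: le_trans (_ : i%:R / M%:R + N%:R^-1 <= _); last first.
    by rewrite lerD2l lef_pV2 ?posrE// ler_nat Lle.
  have -> : i%:R / M%:R + N%:R^-1 = (i * N + M)%:R / (N%:R * M%:R) :> R.
    by rewrite natrD natrM; field; rewrite !gt_eqF.
  have -> : (h i)%:R / N%:R = (h i * M)%:R / (N%:R * M%:R) :> R.
    by rewrite natrM; field; rewrite !gt_eqF.
  rewrite ler_pM2r ?invr_gt0 ?mulr_gt0// ler_nat (leq_trans (hhi i))// leq_add2l.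
  exact: leq_pred.
have h0 : h 0%N = 0%N by rewrite /h mul0n add0n divn_small// prednK.
have hM : h M = N.
  by rewrite /h mulnC divnMDl// divn_small ?addn0// prednK.
have hS i : (h i <= h i.+1)%N by apply: leq_div2r; rewrite leq_add2r leq_mul2r leqnSn orbT.
pose v l := f (X (l%:R / N%:R) w).
rewrite /grid_changes.
have -> : (\sum_(i < N) (f (X (i%:R / N%:R) w) != f (X (i.+1%:R / N%:R) w)) =
   \sum_(i < M) \sum_(h i <= l < h i.+1) (v l != v l.+1))%N.
  by rewrite (sum_refine (fun l => v l != v l.+1) M h0 hS) hM big_mkord.
apply: leq_sum => i _.
have := change_le_sum v (hS i); rewrite /v !hX'//; exact: ltnW.
Qed.

Lemma switch_count_ge0 f w : (0 <= switch_count f X w)%E.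
Proof.
rewrite /switch_count.
have [c|/dvgP ->//] := pselect (cvgn (fun N => ((grid_changes f X N w)%:R%:E : \bar R))).
by apply: lime_ge => //; near=> N; rewrite lee_fin.
Unshelve. all: by end_near. Qed.

(** Almost every path is right-constant at all the countably many grid points, and there the counts
    converge to a limit that dominates each of them. *)
Lemma expectation_switch_ge f N :
  ((N%:R * nu p N%:R^-1 (fun x y => f x != f y))%:E <=
   \int[P]_w switch_count f X w)%E.
Proof.
rewrite -(integral_grid_fun hX); apply: ae_ge0_le_integral => //.
- by move=> w _; rewrite lee_fin.
- exact: (measurable_grid_fun hX).
- by move=> w _; exact: switch_count_ge0.
- exact: (measurable_switch_count hX).
apply: (@negligibleS _ _ _ _ (\bigcup_N \bigcup_i ~` right_const (i%:R / N%:R))); last first.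
  apply: negligible_bigcup => K; apply: negligible_bigcup => i.
  by apply: right_const_ae; rewrite divr_ge0.
move=> w /= nle; apply: contrapT => nbad; apply: nle => _.
apply: (@le_limn R (fun K => grid_changes f X K w)) => K.
apply: grid_refine => K' i; apply: contrapT => bad; apply: nbad.
by exists K' => //; exists i.
Qed.

End RightConstancy.

(** * Sparse blocks *)

Section SparseRegime.
Variables (R : realType) (n m : nat) (p : R).
Hypotheses (p01 : 0 <= p <= 1) (n0 : (0 < n)%N) (m0 : (0 < m)%N) (mn : (m %| n)%N).
Local Notation b := (n %/ m)%N.
Local Notation a := (m%:R * p).
Hypotheses (b2 : (2 <= b)%N) (a_le : a <= 2^-1).

Let p0 : 0 <= p. Proof. by case/andP: p01. Qed.
Let p1 : 0 <= 1 - p. Proof. by rewrite subr_ge0; case/andP: p01. Qed.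
Let a0 : 0 <= a. Proof. by rewrite mulr_ge0. Qed.
Let p_le : p <= 2^-1.
Proof. by apply: le_trans a_le; rewrite ler_peMl// ler1n. Qed.

(** The losses are 2 from [b - 1 >= b / 2], [2 ^ q * q!] from the binomial coefficient against
    [m ^ q], and 2 from [(1 - p) ^+ (m - q) >= 1 / 2]. *)
Definition kappa (q : nat) : R := (4 * 2 ^ q * q`!)%:R^-1.

Lemma kappa_gt0 q : 0 < kappa q.
Proof. by rewrite invr_gt0 ltr0n !muln_gt0 expn_gt0 fact_gt0. Qed.

Lemma mu_crowded_lower q (i : 'I_n) : (0 < q)%N -> (2 * q <= m)%N ->
  b%:R * a ^+ q <= 1 ->
  kappa q * (b%:R * a ^+ q) / 4 <= mu p (fun x : cube n => crowded m q x && ~~ x i).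
Proof.
move=> q0 qm l1.
set L : R := (b.-1 * 'C(m, q))%:R * (p ^+ q * (1 - p) ^+ (m - q)).
have pw1 : (1 - p) ^+ (m - q) <= 1 by rewrite exprn_ile1// gerBl.
have pw2 : 2^-1 <= (1 - p) ^+ (m - q).
  apply: le_trans (bernoulli_ineq _ p01).
  have : (m - q)%:R * p <= a by rewrite ler_wpM2r// ler_nat leq_subr.
  by move: a_le; set u := _ * p; set v := _ * p; lra.
have Llo : kappa q * (b%:R * a ^+ q) <= L.
  rewrite /kappa mulrC ler_pdivrMr ?ltr0n ?muln_gt0 ?expn_gt0 ?fact_gt0//.
  have h1 : (b * m ^ q <= 2 * (2 ^ q * q`!) * (b.-1 * 'C(m, q)))%N.
    have := exp_le_bin qm; move: (_ ^ _)%N (_ ^ _)%N (_`!) ('C(_, _)) => A B F C hA.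
    apply: (@leq_trans ((2 * b.-1) * (A * (F * C)))).
      by rewrite leq_mul//; move: (n %/ m)%N b2 => c c2; lia.
    by rewrite leq_eqVlt; apply/orP; left; apply/eqP; ring.
  have h2 : b%:R * m%:R ^+ q <= (2 * (2 ^ q * q`!) * (b.-1 * 'C(m, q)))%:R :> R.
    by rewrite -natrX -natrM ler_nat.
  rewrite exprMn mulrA; apply: le_trans (ler_wpM2r (exprn_ge0 q p0) h2) _.
  rewrite /L -mulrA [(4 * _ * _)%N](_ : _ = (2 * (2 * (2 ^ q * q`!)))%N); last by lia.
  rewrite natrM; set u := (2 * (2 ^ q * q`!))%N; set v := (b.-1 * _)%N.
  rewrite natrM; have h3 : 0 <= v%:R * p ^+ q * u%:R :> R by rewrite !mulr_ge0 ?exprn_ge0.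
  have := ler_wpM2l h3 pw2; set z := (1 - p) ^+ _; move: (p ^+ q) => y.
  by move: (u%:R) (v%:R) => U V; lra.
have Lhi : L <= b%:R * a ^+ q.
  have cle := @count_le R n m p p01 q 1 ler01.
  rewrite !mulr1 in cle; apply: le_trans cle; rewrite /L.
  apply: ler_pM; rewrite ?mulr_ge0 ?exprn_ge0//.
    by rewrite ler_nat leq_mul2r leq_pred orbT.
  by rewrite ler_piMr ?exprn_ge0.
have L0 : 0 <= L by rewrite /L mulr_ge0 ?mulr_ge0 ?exprn_ge0.
apply: le_trans (mu_crowded_ge p01 m0 mn i q0 (erefl L)).
rewrite ler_pdivrMr//; apply: le_trans Llo _.
have L1 : L <= 1 by apply: le_trans l1.
(* The divisor 4 in the conclusion is one factor 2 from here, using [L <= 1], and one from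
   [1 - p >= 1 / 2]. *)
have h4 : L / 2 <= L - L ^+ 2 / 2 by rewrite expr2; nra.
by move: p_le; nra.
Qed.

Lemma mu_fblk_le r : (0 < r)%N -> mu p (fun x : cube n => fblk m r x) <= b%:R * a ^+ r.
Proof.
move=> r0; apply: le_trans (mu_crowded_le p01 m0 mn r0).
apply: weight_le => [x|x]; first exact: pi_meas_ge0.
by rewrite /fblk; case: ifP => // /crowdedS.
Qed.

Lemma mu_fblk_ge r : (0 < r)%N -> (2 * r <= m)%N -> b%:R * a ^+ r <= 1 ->
  kappa r * (b%:R * a ^+ r) / 4 - b%:R * a ^+ r * a <= mu p (fun x : cube n => fblk m r x).
Proof.
move=> r0 rm l1; rewrite lerBlDr.
(* Any coordinate would do, as the condition on it is dropped below. The function differs from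
   [crowded m r] only on [A], whose weight is the subtracted term. *)
apply: le_trans (mu_crowded_lower (Ordinal n0) r0 rm l1) _.
have := mu_crowded_le p01 m0 mn (ltn0Sn r); rewrite exprSr mulrA.
move=> h; apply: le_trans (lerD (lexx _) h).
apply: le_trans (_ : mu p (fun x : cube n => fblk m r x || crowded m r.+1 x) <= _).
  apply: weight_le => [x|x /andP[cr _]]; first exact: pi_meas_ge0.
  by rewrite /fblk; case: ifP; rewrite ?orbT ?cr.
rewrite /mu big_mkcond [X in _ <= X + _]big_mkcond [X in _ <= _ + X]big_mkcond -big_split.
apply: ler_sum => x _ /=; have := pi_meas_ge0 p01 x; move: (pi_meas p x) => w w0.
by case: (fblk m r x); case: (crowded m r.+1 x); rewrite /= ?addr0 ?add0r// lerDl.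
Qed.

Lemma half_le_1BexpN (s : R) : 0 <= s <= 1 -> s / 2 <= 1 - expR (- s).
Proof.
move=> /andP[s0 s1]; have h := expR_ge1Dx s; have e0 := expR_gt0 (- s).
have : expR (- s) * expR s = 1 by rewrite -expRD addNr expR0.
move: (expR s) (expR (- s)) h e0 => u v hu hv uv.
have h1 : v * (1 + s) <= (1 - s / 2) * (1 + s).
  apply: (@le_trans _ _ 1); first by rewrite -[leRHS]uv ler_pM2l.
  by nra.
by move: h1; rewrite ler_pM2r; lra.
Qed.

(** The time step [1 / n] makes silence of all clocks cost only [e^(-1)], while a given clock still
    rings with probability at least [1 / (2 n)]. The factor 8 is this 2 times the 4 of
    [mu_crowded_lower]. *)
Lemma energy_fblk_ge r : (0 < r)%N -> (2 * r.+1 <= m)%N -> b%:R * a ^+ r <= 1 ->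
  kappa r.+1 * (b%:R * a ^+ r) * (n%:R * p * a) * (expR (-1) / 8) <=
  n%:R * nu p n%:R^-1 (fun x y : cube n => fblk m r x != fblk m r y).
Proof.
move=> r0 rm l1; set s : R := n%:R^-1.
have n0R : 0 < n%:R :> R by rewrite ltr0n.
have s0 : 0 <= s by rewrite invr_ge0 ltW.
have s1 : s <= 1 by rewrite invf_le1// ler1n.
have l1' : b%:R * a ^+ r.+1 <= 1.
  by rewrite exprSr mulrA mulr_ile1 ?mulr_ge0 ?exprn_ge0//; apply: le_trans a_le _; lra.
have := nu_fblk_ge p01 m0 mn r0 s0; rewrite -expRM_natl mulrN /s mulfV ?gt_eqF// -/s => h.
rewrite -ler_pdivrMl// -/s; apply: le_trans h.
apply: le_trans (_ : expR (-1) * (s / 2 * p) * (n%:R * (kappa r.+1 * (b%:R * a ^+ r.+1) / 4)) <= _).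
  rewrite exprSr le_eqVlt; apply/orP; left; apply/eqP.
  move: (kappa _) (a ^+ r) (expR (-1)) a => K z e aa; by field.
apply: ler_pM.
- by rewrite !mulr_ge0 ?expR_ge0.
- by rewrite !mulr_ge0 ?exprn_ge0// ltW// kappa_gt0.
- rewrite ler_wpM2l ?expR_ge0// ler_wpM2r// half_le_1BexpN// s0 s1//.
rewrite -{1}[n](card_ord n) mulr_natl -sumr_const; apply: ler_sum => i _.
exact: mu_crowded_lower.
Qed.

(** With [lambda <= 1 / 2], meeting [A] on the grid costs [lambda a (1 + 2 (r + 1)) <= a (r + 2)],
    and Markov's inequality for [crowded m r] costs [2 r lambda / k <= r / k]. The bound is uniform
    in [N]. *)
Lemma grid_changes_tail_fblk r d (Omega : measurableType d) (P : probability Omega R)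
    (X : R -> Omega -> cube n) (k N : nat) :
  biased_rw P p X -> (0 < r)%N -> (0 < k)%N -> (0 < N)%N -> b%:R * a ^+ r <= 2^-1 ->
  (P [set w | (k <= grid_changes (fblk m r) X N w)%N] <=
    (a * r.+2%:R + r%:R / k%:R)%:E)%E.
Proof.
move=> hX r0 k0 N0 l1.
have N0R : 0 < N%:R :> R by rewrite ltr0n.
have k0R : 0 < k%:R :> R by rewrite ltr0n.
have sN : 0 <= N%:R^-1 :> R by rewrite invr_ge0 ltW.
have l0 : 0 <= b%:R * a ^+ r by rewrite mulr_ge0 ?exprn_ge0.
have A1 := mu_crowded_le p01 m0 mn (ltn0Sn r).
have A2 := nu_crowded_change_le p01 m0 mn (ltn0Sn r) sN.
have A3 := nu_crowded_change_le p01 m0 mn r0 sN.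
have := @prob_grid_tail _ _ _ P n p X hX (fblk m r) (crowded m r) (crowded m r.+1) N k.
have fg (x : cube n) : ~~ crowded m r.+1 x -> fblk m r x = crowded m r x.
  by rewrite /fblk => /negPf ->.
move=> /(_ fg)/le_trans; apply; rewrite [leRHS]EFinD; apply: leeD.
  rewrite lee_fin; move: A1 A2; rewrite exprSr mulrA.
  set l' := b%:R * _ in l0 l1 *; set v := nu _ _ _ => A1 A2.
  have A2' : N%:R * v <= l' * a * (2 * r.+1%:R).
    rewrite mulrC -ler_pdivlMr//; apply: le_trans A2 _.
    by rewrite -!mulrA.
  apply: le_trans (lerD A1 A2') _.
  have h : 0 <= (2^-1 - l') * (a * (2 * r%:R + 3)).
    by rewrite mulr_ge0 ?subr_ge0 ?mulr_ge0 ?addr_ge0 ?mulr_ge0.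
  move: h a0 {l0 l1 A1 A2 A2'}; rewrite -(addn1 r.+1) -(addn1 r) !natrD.
  move: (a) (r%:R) l' => u w y; lra.
rewrite -(@lee_pmul2l _ k%:R%:E) ?lte_fin//.
apply: le_trans (prob_grid_ge hX _ _ _) _; rewrite -EFinM lee_fin.
rewrite [leRHS]mulrCA mulfV ?gt_eqF// mulr1 mulrC -ler_pdivlMr//.
apply: le_trans A3 _; move: l1 l0; set y := _ * _ ^+ r => l1 l0.
rewrite mulrA ler_wpM2r// mulrA ler_piMl//.
by move: l1; lra.
Qed.

End SparseRegime.

(** * Choice of the block length *)

Section Admissible.
Variables (R : realType) (p : nat -> R) (q : nat).
Hypotheses (hp01 : forall n, (1 <= n)%N -> 0 < p n < 1)
  (hdecr : forall n m, (1 <= n)%N -> (n <= m)%N -> p m <= p n)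
  (hA : (fun n => n%:R * p n) @ \oo --> +oo)
  (hB : (fun n => n%:R * p n ^+ q.+1) @ \oo --> (0 : R)).

Definition lam (n m : nat) : R := (n %/ m)%N%:R * (m%:R * p n) ^+ q.+1.

(** The window is what rounding leaves of the level [1 / 4]: below, a factor 2 is lost for [n] and
    [2 ^ q] for passing from [m + 1] to [m]; above, a factor 2 for the change of [p]. *)
Definition admissible (n m : nat) :=
  [/\ (0 < m)%N, (m %| n)%N & (4 * 2 ^ q.+1)%:R^-1 <= lam n m <= 2^-1].

Lemma lamE n m : (0 < m)%N -> (m %| n)%N -> lam n m = n%:R * m%:R ^+ q * p n ^+ q.+1.
Proof.
move=> m0 mn; have -> : n%:R = (n %/ m)%N%:R * m%:R :> R by rewrite -natrM divnK.
by rewrite /lam exprMn exprS; ring.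
Qed.

Lemma np_large (K : R) : exists n1, forall n, (n1 <= n)%N -> K <= n%:R * p n.
Proof. by have /cvgryPge/(_ K)[n1 _ h] := hA; exists n1 => n /h. Qed.

Lemma npr_small (e : R) : 0 < e ->
  exists n1, forall n, (n1 <= n)%N -> n%:R * p n ^+ q.+1 <= e.
Proof.
move=> e0; have /cvgr0Pnorm_le/(_ _ e0)[n1 _ h] := hB; exists n1 => n /h /=.
exact: le_trans (ler_norm _).
Qed.

(** Write [a = m p_n], so that [lam = n p_n a^q]. Bounded [lam] with (A) forces [a] to be small;
    [lam] bounded below with (B) forces [m] to be large; [b a = n p_n] makes [b] large; and
    [(n p_n a)^q = lam (n p_n)^(q - 1)] is large when [q > 1]. *)
Lemma regime (e : R) (K : nat) : (0 < q)%N -> 0 < e ->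
  exists n1, forall n m, (n1 <= n)%N -> admissible n m ->
    [/\ m%:R * p n <= e, (K <= m)%N, (K <= n %/ m)%N &
       (1 < q)%N -> K%:R <= n%:R * p n * (m%:R * p n)].
Proof.
move=> q0 e0.
pose c : R := (4 * 2 ^ q.+1)%:R^-1.
have c0 : 0 < c by rewrite invr_gt0 ltr0n muln_gt0 expn_gt0.
pose e' := Num.min e 1.
have e'0 : 0 < e' by rewrite lt_min e0 ltr01.
have [n1 h1] := np_large (e' ^+ q)^-1.
have [n2 h2] := np_large (K%:R + 1).
have [n3 h3] := np_large (K.+1%:R ^+ q / c + 1).
have [n4 h4] := npr_small (e := c / 2 / K.+1%:R ^+ q)
  (divr_gt0 (divr_gt0 c0 (ltr0Sn R 1)) (exprn_gt0 _ (ltr0Sn _ _))).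
exists (n1 + n2 + n3 + n4 + 1)%N => n m hn.
have [n0 hn1] : (0 < n /\ n1 <= n)%N by lia.
have [hn2 [hn3 hn4]] : (n2 <= n /\ n3 <= n /\ n4 <= n)%N by lia.
move=> [m0 mn /andP[lc lu]].
have /andP[p0 p1] := hp01 n0.
have m0R : 0 < m%:R :> R by rewrite ltr0n.
have n0R : 0 < n%:R :> R by rewrite ltr0n.
set a := m%:R * p n; have a0 : 0 < a by rewrite mulr_gt0.
have lamE' : lam n m = n%:R * p n * a ^+ q.
  by rewrite lamE// /a exprMn exprS; ring.
have ae' : a <= e'.
  rewrite leNgt; apply/negP => ea.
  have h : 1 <= n%:R * p n * a ^+ q.
    rewrite -[X in X <= _](@mulVf _ (e' ^+ q)) ?gt_eqF ?exprn_gt0//.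
    apply: ler_pM.
    - by rewrite invr_ge0 exprn_ge0// ltW.
    - by rewrite exprn_ge0// ltW.
    - exact: h1.
    - by apply: lerXn2r; rewrite ?nnegrE ltW.
  by move: lu; rewrite lamE'; move: h; set y := _ * _ ^+ q; lra.
have ae : a <= e by apply: le_trans ae' _; rewrite ge_min lexx.
have a1 : a <= 1 by apply: le_trans ae' _; rewrite ge_min lexx orbT.
have ba : (n %/ m)%:R * a = n%:R * p n.
  by rewrite /a mulrA -natrM divnK.
split => //.
- rewrite leqNgt; apply/negP => mK.
  have : lam n m <= c / 2.
    rewrite lamE// mulrAC -ler_pdivlMr ?exprn_gt0//.
    apply: le_trans (h4 _ hn4) _.
    rewrite ler_wpM2l ?divr_ge0 ?(ltW c0)// lef_pV2 ?posrE ?exprn_gt0//.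
    by apply: lerXn2r; rewrite ?nnegrE ?ler_nat// ltnW// ltnW.
  by move: lc; rewrite -/c; lra.
- rewrite -(ler_nat R); apply: le_trans (_ : (n %/ m)%:R * a <= _).
    by rewrite ba; apply: le_trans (h2 _ hn2); rewrite lerDl.
  by rewrite ler_piMr.
move=> q1; rewrite leNgt; apply/negP => aK.
set y := n%:R * p n in lamE' aK *.
have y1 : 1 <= y by apply: le_trans (h3 n hn3); rewrite lerDr divr_ge0 ?exprn_ge0 ?ltW.
have yK : K.+1%:R ^+ q / c + 1 <= y by exact: h3.
have : c * y <= K.+1%:R ^+ q.
  apply: le_trans (_ : lam n m * y ^+ q.-1 <= _).
    apply: ler_pM; rewrite ?(ltW c0) ?(le_trans ler01)//.
    by rewrite -{1}[y]expr1 ler_weXn2l// -ltnS prednK.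
  rewrite lamE' mulrAC -exprS prednK// -exprMn.
  have ya0 : 0 <= y * a := mulr_ge0 (le_trans ler01 y1) (ltW a0).
  apply: lerXn2r; rewrite ?nnegrE//.
  by apply: le_trans (ltW aK) _; rewrite ler_nat.
rewrite mulrC -ler_pdivlMr// => h.
by have := le_trans yK h; rewrite gerDl ler10.
Qed.

Hypothesis hC : forall phi : nat -> nat, (forall n, (0 < phi n)%N) ->
     (fun n => `|n%:R - (phi n)%:R| / (minn n (phi n))%:R) @ \oo --> (0 : R) ->
     (fun n => p n / p (phi n)) @ \oo --> (1 : R).

(** The closed form of [lam] from [lamE], with divisibility dropped: [m] is the last length at which
    it is at most [1 / 4]. *)
Definition fits (n m : nat) :=
  [/\ (0 < m)%N, n%:R * m%:R ^+ q * p n ^+ q.+1 <= 4^-1 &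
    4^-1 < n%:R * m.+1%:R ^+ q * p n ^+ q.+1].

Lemma fits_exists : (0 < q)%N -> exists n1, forall n, (n1 <= n)%N -> exists m, fits n m.
Proof.
move=> q0; have [n1 h1] := np_large 1.
have [n2 h2] := npr_small (e := 4^-1) ltac:(by rewrite invr_gt0).
exists (n1 + n2 + 1)%N => n hn.
have n0 : (0 < n)%N by lia.
have /andP[p0 p1] := hp01 n0.
pose Q (m : nat) := (n%:R * m%:R ^+ q * p n ^+ q.+1 <= 4^-1).
have Q1 : exists m, Q m by exists 1%N; rewrite /Q expr1n mulr1; apply: h2; lia.
(* A maximum exists because a length beyond [n] would give at least [(n p_n) ^+ q.+1 >= 1]. *)
have Qb m : Q m -> (m <= n)%N.
  rewrite /Q => Qm; rewrite leqNgt; apply/negP => nm; move: Qm; rewrite leNgt => /negP; apply.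
  apply: lt_le_trans (_ : 1 <= _); first by lra.
  apply: le_trans (_ : (n%:R * p n) ^+ q.+1 <= _).
    by rewrite exprn_ege1// h1//; lia.
  rewrite exprMn exprS ler_wpM2r ?exprn_ge0 ?(ltW p0)//.
  rewrite ler_wpM2l// lerXn2r ?nnegrE// ler_nat; exact: ltnW.
have [m Qm mx] := ex_maxnP Q1 Qb; exists m; split => //.
  by apply: (mx 1%N); rewrite /Q expr1n mulr1; apply: h2; lia.
by rewrite ltNge; apply/negP => /mx; rewrite ltnn.
Qed.

(** Rounding [n] to a multiple of [m] moves it by less than [m], so this is the relative error that
    (C) asks to vanish. A length above [e n] would give at least [e^q (n p_n)^(q + 1) >= 1]. *)
Lemma fits_small (e : R) : (0 < q)%N -> 0 < e -> exists n1, forall n m, (n1 <= n)%N ->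
  fits n m -> m%:R <= e * n%:R.
Proof.
move=> q0 e0; have [n1 h1] := np_large ((e ^+ q)^-1 + 1).
exists (n1 + 1)%N => n m hn.
have [n0 hn1] : (0 < n /\ n1 <= n)%N by lia.
move=> [m0 Qm _].
have /andP[p0 p1] := hp01 n0.
rewrite leNgt; apply/negP => em; move: Qm; rewrite leNgt => /negP; apply.
apply: lt_le_trans (_ : 1 <= _); first by lra.
have y1 : 1 <= n%:R * p n.
  by apply: le_trans (h1 n hn1); rewrite lerDr invr_ge0 exprn_ge0 ?ltW.
apply: le_trans (_ : e ^+ q * (n%:R * p n) ^+ q.+1 <= _).
  rewrite -[X in X <= _](@mulfV _ (e ^+ q)) ?gt_eqF ?exprn_gt0//.
  apply: ler_wpM2l; rewrite ?exprn_ge0 ?(ltW e0)//.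
  apply: le_trans (_ : n%:R * p n <= _).
    by apply: le_trans (h1 n hn1); rewrite lerDl.
  by rewrite -{1}[_ * _]expr1 ler_weXn2l.
rewrite exprMn mulrA; apply: ler_wpM2r; first by rewrite exprn_ge0 ?ltW.
rewrite exprS mulrCA ler_wpM2l// -exprMn.
by apply: lerXn2r; rewrite ?nnegrE ?mulr_ge0 ?(ltW e0)// ltW.
Qed.

Lemma admissible_unbounded K : (0 < q)%N ->
  exists n m, (K <= n)%N /\ (0 < n)%N /\ admissible n m.
Proof.
move=> q0; have [n1 h1] := fits_exists q0.
have /choice[mf mfP] : forall n, exists m, (n1 <= n)%N -> fits n m.
  by move=> n; have [/h1[m hm]|_] := leqP n1 n; [exists m|exists 0%N].
have half0 : 0 < 2^-1 :> R by rewrite invr_gt0.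
have [n2 h2] := fits_small q0 half0.
(* Round [n] down to a multiple of the block length; [p] hardly changes. *)
pose phi n := if (n1 + n2 + 1 <= n)%N then (n %/ mf n * mf n)%N else 1%N.
have phiP n : (n1 + n2 + 1 <= n)%N -> [/\ phi n = (n %/ mf n * mf n)%N,
    (n - phi n < mf n)%N, (phi n <= n)%N & (n <= 2 * phi n)%N].
  move=> hn; have fm := mfP n ltac:(lia); have [m0 _ _] := fm.
  have mn := h2 n (mf n) ltac:(lia) fm.
  have m2n : (2 * mf n <= n)%N.
    by rewrite -(ler_nat R) natrM; lra.
  rewrite /phi hn; have := divn_eq n (mf n); have := ltn_pmod n m0.
  set y := (_ * _)%N; split => //; lia.
(* The filler value 1 below the threshold serves this: [hC] wants positivity at every index. *)
have phi0 n : (0 < phi n)%N.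
  have [hn|hn] := leqP (n1 + n2 + 1) n; first by have [_ _ _] := phiP n hn; lia.
  by rewrite /phi; case: ifP => // h; move: hn; rewrite ltnNge h.
have cv : (fun n => `|n%:R - (phi n)%:R| / (minn n (phi n))%:R) @ \oo --> (0 : R).
  apply/cvgr0Pnorm_le => e e0.
  have [n3 h3] := fits_small q0 (divr_gt0 e0 (ltr0Sn R 1)).
  exists (n1 + n2 + n3 + 1)%N => // n /= hn.
  have [pE plt ple phalf] := phiP n ltac:(lia).
  have mn := h3 n (mf n) ltac:(lia) (mfP n ltac:(lia)).
  have p0R : 0 < (phi n)%:R :> R by rewrite ltr0n.
  rewrite (minn_idPr ple) -natrB// !normr_nat ger0_norm ?divr_ge0//.
  rewrite ler_pdivrMr//; apply: le_trans (_ : (mf n)%:R <= _).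
    by rewrite ler_nat ltnW.
  apply: le_trans mn _.
  have : n%:R <= 2 * (phi n)%:R :> R by rewrite -natrM ler_nat.
  by move: (n%:R) ((phi n)%:R) => u v huv; nra.
have cvp := hC phi0 cv.
have [u [u0 u1 qu]] : exists u : R, [/\ 0 < u, u <= 1 & q.+1%:R * u = 1].
  exists q.+1%:R^-1; rewrite mulfV ?pnatr_eq0// invr_gt0 ltr0n.
  by rewrite invf_le1 ?ltr0n// ler1n.
(* With [u = 1 / (q + 1)], Bernoulli's inequality gives [al ^+ q.+1 >= 1 / 2], so a ratio of [p] at
   least [al] costs a factor of at most 2 in [lam]. *)
pose al : R := 1 - u / 2.
have al1 : al < 1 by rewrite /al; lra.
have al0 : 0 < al by rewrite /al; lra.
have alq : 2^-1 <= al ^+ q.+1.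
  apply: le_trans (bernoulli_ineq _ _); last by lra.
  by rewrite mulrA qu; lra.
have [n4 h4] : exists n4, forall n, (n4 <= n)%N -> al <= p n / p (phi n).
  have /cvgr_ge/(_ _ al1)[n4 _ h] := cvp; by exists n4 => n /h.
(* [2 * K] because the rounded index is only known to be at least [n / 2]. *)
have [n [hn hn1 hn4 hnK]] : exists n, [/\ n1 + n2 + 1 <= n, n1 <= n, n4 <= n & 2 * K <= n]%N.
  by clear; exists (n1 + n2 + n4 + 2 * K + 1)%N; split; lia.
have fm := mfP n hn1; have [m0 lo hi] := fm.
have [pE plt ple phalf] := phiP n hn.
set m := mf n in pE plt m0 lo hi fm; set N := phi n in pE plt ple phalf.
exists N, m; split.
  by rewrite -(leq_pmul2l (isT : 0 < 2)%N) (leq_trans hnK).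
have N0 : (0 < N)%N by exact: phi0.
split => //; have mN : (m %| N)%N by rewrite pE dvdn_mull.
split => //; rewrite lamE//.
have n0 : (0 < n)%N by apply: leq_trans ple.
have /andP[pn0 pn1] := hp01 n0.
have /andP[pN0 pN1] := hp01 N0.
have pnN : p n <= p N by exact: hdecr.
have pNn : p N * al <= p n.
  by have := h4 n hn4; rewrite ler_pdivlMr// mulrC.
have m1 : m.+1%:R <= 2 * m%:R :> R by rewrite -natrM ler_nat mul2n -addnn -addn1 leq_add2l.
have phR : n%:R <= 2 * N%:R :> R by rewrite -natrM ler_nat.
apply/andP; split.
  rewrite natrM invfM natrX -ler_pdivlMr ?invr_gt0 ?exprn_gt0// invrK.
  apply: ltW; apply: lt_le_trans hi _.
  apply: le_trans (_ : (2 * N%:R) * (2 * m%:R) ^+ q * p N ^+ q.+1 <= _).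
    apply: ler_pM; rewrite ?mulr_ge0 ?exprn_ge0 ?(ltW pn0)//; last first.
      by rewrite lerXn2r ?nnegrE ?(ltW pn0) ?(ltW pN0).
    by apply: ler_pM; rewrite ?exprn_ge0// lerXn2r ?nnegrE ?mulr_ge0.
  by rewrite le_eqVlt; apply/orP; left; apply/eqP; rewrite exprMn !exprS; ring.
apply: le_trans (_ : n%:R * m%:R ^+ q * (2 * p n ^+ q.+1) <= _); last first.
  by rewrite mulrCA; lra.
apply: ler_pM; rewrite ?mulr_ge0 ?exprn_ge0 ?(ltW pN0)//.
  by apply: ler_wpM2r; rewrite ?exprn_ge0// ler_nat.
have : (p N * al) ^+ q.+1 <= p n ^+ q.+1.
  by apply: lerXn2r; rewrite ?nnegrE ?mulr_ge0 ?(ltW pN0) ?(ltW pn0) ?(ltW al0).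
rewrite exprMn; have : 0 <= p N ^+ q.+1 by rewrite exprn_ge0 ?ltW.
by move: (p N ^+ _) (p n ^+ _) (al ^+ _) alq => P1 P2 P3; nra.
Qed.

End Admissible.

Local Open Scope ring_scope.

Theorem theorem1 (R : realType) (p : nat -> R)
  (hp01 : forall n, (1 <= n)%N -> 0 < p n < 1)
  (hdecr : forall n m, (1 <= n)%N -> (n <= m)%N -> p m <= p n)
  (hA : (fun n => n%:R * p n) @ \oo --> +oo)
  (hB : exists r : nat, (2 <= r)%N /\ (fun n => n%:R * p n ^+ r) @ \oo --> (0 : R))
  (hC : forall phi : nat -> nat, (forall n, (0 < phi n)%N) ->
     (fun n => `|n%:R - (phi n)%:R| / (minn n (phi n))%:R) @ \oo --> (0 : R) ->
     (fun n => p n / p (phi n)) @ \oo --> (1 : R)) :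
  exists (NN : set nat) (f : forall n : nat, cube n -> bool),
    infinite_set NN /\
    forall (d : measure_display) (Omega : measurableType d)
           (P : probability Omega R) (X : forall n : nat, R -> Omega -> cube n),
      (forall n, biased_rw P (p n) (X n)) ->
      [/\ (* (a) non-degenerate *)
          (exists delta : R, 0 < delta /\ exists n0 : nat, forall n, NN n -> (n0 <= n)%N ->
             (delta%:E <= P [set w | f n (X n 0%R w)] <= (1 - delta)%:E)%E),
          (* (b) transitive *)
          (forall n, NN n -> transitive_fun (f n)),
          (* (c) tame *)
          (forall eps : R, 0 < eps -> exists k : nat, (1 <= k)%N /\ exists n0 : nat,
             forall n, NN n -> (n0 <= n)%N ->
             (P [set w | (k%:R%:E <= switch_count (f n) (X n) w)%E] < eps%:E)%E) &
          (* (d) E[C_n] -> oo along NN *)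
          (forall M : R, exists n0 : nat, forall n, NN n -> (n0 <= n)%N ->
             (M%:E < \int[P]_w switch_count (f n) (X n) w)%E)].
Proof.
(* [q.+1] is the exponent written [r] in the overview. *)
have [q [q1 hBq]] : exists q : nat, (1 < q)%N /\ (fun n => n%:R * p n ^+ q.+1) @ \oo --> (0 : R).
  have [r [r2 hr]] := hB; exists r; split => //.
  apply/cvgr0Pnorm_le => e e0; have /cvgr0Pnorm_le/(_ _ e0)[n1 _ h] := hr.
  exists (n1 + 1)%N => // n /= hn; apply: le_trans (h n _); last by rewrite /=; lia.
  have /andP[p0 p1] := hp01 n ltac:(lia).
  rewrite !ger0_norm ?mulr_ge0 ?exprn_ge0 ?(ltW p0)//; apply: ler_wpM2l => //.
  by rewrite [leLHS]exprS ler_piMl ?exprn_ge0 ?ltW.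
have q0 : (0 < q)%N by apply: ltnW.
(* The default length 1 is harmless, since [NN] asks again that the chosen length be admissible. *)
pose mm n := xget 1%N [set m | admissible p q n m].
pose NN := [set n | (0 < n)%N /\ admissible p q n (mm n)].
have NNP n m : (0 < n)%N -> admissible p q n m -> NN n.
  move=> n0 nm; split => //; rewrite /mm; case: xgetP => [x ->//|] /(_ m).
  by case.
exists NN, (fun n => fblk (mm n) q.+1); split.
  move=> /finite_seqP[s sE].
  have [n [m [nK [n0 nm]]]] := admissible_unbounded hp01 hdecr hA hBq hC (\max_(i <- s) i)%N.+1 q0.
  have : NN n by exact: NNP nm.
  rewrite sE /= => ns.
  have : (n <= \max_(i <- s) i)%N by exact: leq_bigmax_seq.
  by rewrite leqNgt nK.
move=> d Omega P X hX.
have pw n : NN n -> 0 <= p n <= 1.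
  by move=> [n0 _]; have /andP[/ltW -> /ltW ->] := hp01 n n0.
pose c : R := (4 * 2 ^ q.+1)%:R^-1.
have c0 : 0 < c by rewrite invr_gt0 ltr0n muln_gt0 expn_gt0.
have half0 : 0 < 2^-1 :> R by rewrite invr_gt0.
have half1 : 2^-1 <= 1 :> R by rewrite invf_le1 ?ler1n.
have good (e : R) (K : nat) : 0 < e -> exists n0, forall n, NN n -> (n0 <= n)%N ->
  [/\ 0 <= p n <= 1, ((0 < n) && (0 < mm n))%N, (mm n %| n)%N,
      (2 <= n %/ mm n)%N /\ (2 * q.+2 <= mm n)%N &
   [/\ (mm n)%:R * p n <= 2^-1, (mm n)%:R * p n <= e,
     K%:R <= n%:R * p n * ((mm n)%:R * p n) & c <= lam p q n (mm n) <= 2^-1]].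
  move=> e0.
  have e0' : 0 < Num.min 2^-1 e by rewrite lt_min half0.
  (* One bound serves three demands: energy at least [K], at least two blocks, and [m >= 2 (q + 2)]
     as needed for crowding at level [q + 2]. *)
  have [n0 hn0] := regime hp01 hA hBq (K + 2 * q.+2)%N q0 e0'.
  exists n0 => n nNN nn; have [h1 h2 h3 h4] := hn0 n (mm n) nn nNN.2.
  have [n_gt0 [m0 mn lc]] := nNN.
  split; [exact: pw|by rewrite n_gt0|by []| |].
    have two : (2 <= K + 2 * q.+2)%N by clear; lia.
    by split; [exact: leq_trans two h3|exact: leq_trans (leq_addl _ _) h2].
  move: h1; rewrite le_min => /andP[-> ->]; split => //.
  by apply: le_trans (h4 q1); rewrite ler_nat leq_addr.
split.
(* The main term [kappa lam / 4] is at least [2 de]. As [lam <= 1 / 2] and [a <= 2 de], the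
   correction [lam a] is at most [de]. *)
- pose de := kappa R q.+1 * c / 8.
  have de0 : 0 < de by rewrite divr_gt0// mulr_gt0// kappa_gt0.
  have [n0 hn0] := good (2 * de) 0%N (mulr_gt0 (ltr0Sn R 1) de0).
  exists (Num.min de 2^-1); split; first by rewrite lt_min de0.
  exists n0 => n nNN nn.
  have [p01 /andP[n_gt0 m0] mn [b2 m2] [a1 a2 _ /andP[lc lu]]] := hn0 n nNN nn.
  rewrite (prob_mu (hX n) (fblk (mm n) q.+1) (lexx 0)) !lee_fin.
  have hi := mu_fblk_le p01 m0 mn (ltn0Sn q).
  have lo := mu_fblk_ge p01 n_gt0 m0 mn b2 a1 (ltn0Sn q).
  have m2' : (2 * q.+1 <= mm n)%N.
    by apply: leq_trans m2; rewrite leq_mul2l leqnSn.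
  have {}lo := lo m2' (le_trans lu half1).
  apply/andP; split; last first.
    apply: le_trans hi (le_trans lu _).
    have : Num.min de 2^-1 <= 2^-1 by rewrite ge_min lexx orbT.
    by lra.
  apply: le_trans (_ : de <= _); first by rewrite ge_min lexx.
  apply: le_trans lo; rewrite -/(lam p q n (mm n)).
  have k0 := kappa_gt0 R q.+1.
  have a0 : 0 <= (mm n)%:R * p n by rewrite mulr_ge0//; case/andP: p01.
  move: a0 a2 k0 lc lu; rewrite /de; move: (kappa _ _) (lam _ _ _ _) (_%:R * _) => k l a.
  move=> a0 a2 k0 lc lu.
  have := ler_wpM2l (ltW k0) lc; nra.
- by move=> n [n0 [m0 mn _]]; exact: fblk_transitive.
- move=> eps eps0.
  (* Markov's term and the cost of [A] each get [eps / 4], which leaves room for the strict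
     inequality. *)
  pose k := (Num.truncn (q.+1%:R / (eps / 4))).+1.
  have kP : q.+1%:R / k%:R <= eps / 4.
    rewrite ler_pdivrMr ?ltr0n// mulrC -ler_pdivrMr ?divr_gt0//.
    by apply: ltW; exact: truncnS_gt.
  exists k; split => //.
  have e0 : 0 < eps / 4 / q.+3%:R by rewrite !divr_gt0.
  have [n0 hn0] := good _ 0%N e0.
  exists n0 => n nNN nn.
  have [p01 /andP[n_gt0 m0] mn [b2 m2] [a1 a2 _ /andP[lc lu]]] := hn0 n nNN nn.
  apply: (@le_lt_trans _ _ (eps / 2)%:E); last by rewrite lte_fin; lra.
  apply: (prob_switch_tail (hX n)) => // N N0.
  apply: le_trans (grid_changes_tail_fblk p01 m0 mn (hX n) (ltn0Sn q) (ltn0Sn _) N0 lu) _.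
  rewrite lee_fin; move: a2; rewrite ler_pdivlMr// => a2.
  by apply: le_trans (lerD a2 kP) _; lra.
- move=> M.
  pose g : R := kappa R q.+2 * c * (expR (-1) / 8).
  have g0 : 0 < g by rewrite !mulr_gt0 ?kappa_gt0 ?expR_gt0 ?invr_gt0.
  pose K := (Num.truncn (M / g)).+1.
  have [n0 hn0] := good 1 K ltr01.
  exists n0 => n nNN nn.
  have [p01 /andP[n_gt0 m0] mn [b2 m2] [a1 _ aK /andP[lc lu]]] := hn0 n nNN nn.
  apply: lt_le_trans (expectation_switch_ge p01 (hX n) _ n).
  rewrite lte_fin.
  have := energy_fblk_ge p01 n_gt0 m0 mn b2 a1 (ltn0Sn q) m2 (le_trans lu half1).
  move=> /(lt_le_trans _); apply; rewrite -/(lam p q n (mm n)).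
  have : M < g * K%:R by rewrite mulrC -ltr_pdivrMr//; exact: truncnS_gt.
  move=> /lt_le_trans; apply; rewrite /g [leLHS]mulrAC.
  apply: ler_wpM2r; first by rewrite divr_ge0 ?expR_ge0.
  apply: ler_pM => //; first by rewrite mulr_ge0 ?(ltW c0) ?(ltW (kappa_gt0 _ _)).
  by apply: ler_wpM2l; rewrite ?(ltW (kappa_gt0 _ _)).
Qed.
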